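(* Let $R$ be a $\sigma$-compact locally compact Hausdorff space and let $\varphi$ be a conjugate functional on the class $\mathcal{K}$ of compact subsets of $R$, with $\varphi(\varnothing)=1$. Then $\varphi$ is the zero probability function of a general Poisson process (i.e. there is a general Poisson process $N$ with $\varphi(Q)=\mathbb{P}(N(Q)=0)$ for all $Q\in\mathcal{K}$) if and only if $\varphi$ is strictly positive and satisfies $$\varphi(Q_1)\varphi(Q_2)=\varphi(Q_1\cup Q_2)\,\varphi(Q_1\cap Q_2)$$ for every pair $Q_1,Q_2$ of $\mathcal{K}$.
   Context: A function $\psi:\mathcal{K}\to[0,\infty)$ is continuous on the right if for every $E\in\mathcal{K}$ and $\varepsilon>0$ there is an open $G\supseteq E$ with $|\psi(F)-\psi(E)|<\varepsilon$ whenever $F\in\mathcal{K}$ and $E\subseteq F\subseteq G$. A conjugate functional is a function $\varphi:\mathcal{K}\to[0,\infty)$ that is decreasing ($\varphi(E)\ge\varphi(F)$ if $E\subseteq F$) and continuous on the right. A valuation is an increasing, continuous on the right function $\Phi:\mathcal{K}\to[0,\infty)$ with $\Phi(\varnothing)=0$ and $\Phi(Q_1)+\Phi(Q_2)=\Phi(Q_1\cup Q_2)+\Phi(Q_1\cap Q_2)$ for all $Q_1,Q_2\in\mathcal{K}$. A point process is a family $N(Q)$, $Q\in\mathcal{K}$, of nonnegative integer-valued random variables on a probability space $(\Omega,\mathcal{B},\mathbb{P})$ such that $Q\mapsto N(Q)$ is a (random) valuation. It is a general Poisson process if there is a Radon measure $\lambda$ on $R$ such that for any disjoint compact sets $Q_1,\ldots,Q_k$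 and nonnegative integers $n_1,\ldots,n_k$, $$\mathbb{P}(N(Q_i)=n_i,\ i=1,\ldots,k)=\prod_{i=1}^k e^{-\lambda(Q_i)}\frac{[\lambda(Q_i)]^{n_i}}{n_i!}.$$ The measure $\lambda$ may have atoms. A Radon measure is a Borel measure, finite on compact sets, inner regular on open sets and outer regular on Borel sets. *)

(* Defs.v *)
From HB Require Import structures.
From mathcomp Require Import all_boot all_order all_algebra.
From mathcomp Require Import all_classical all_reals all_analysis.
Set Implicit Arguments.
Unset Strict Implicit.
Unset Printing Implicit Defensive.
Import Order.TTheory GRing.Theory Num.Theory.
Import numFieldNormedType.Exports.
Local Open Scope classical_set_scope.
Local Open Scope ring_scope.

Definition sigma_compact (T : topologicalType) : Prop :=
  exists K : nat -> set T, (forall n, compact (K n)) /\ \bigcup_n K n = [set: T].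

(* A functional on the compact subsets of T is a function on [set T] whose
   values outside the compact sets are irrelevant: no predicate below looks at
   them. *)

Definition continuous_on_the_right (R : realType) (T : topologicalType)
    (psi : set T -> R) : Prop :=
  forall (E : set T) (eps : R), compact E -> 0 < eps ->
  exists G : set T, [/\ open G, E `<=` G &
    forall F : set T, compact F -> E `<=` F -> F `<=` G ->
      `|psi F - psi E| < eps].

Definition conjugate_functional (R : realType) (T : topologicalType)
    (phi : set T -> R) : Prop :=
  [/\ forall Q, compact Q -> 0 <= phi Q,
      forall E F, compact E -> compact F -> E `<=` F -> phi F <= phi E &
      continuous_on_the_right phi].

Definition valuation (R : realType) (T : topologicalType)
    (Phi : set T -> R) : Prop :=
  [/\ forall Q, compact Q -> 0 <= Phi Q,
      forall E F, compact E -> compact F -> E `<=` F -> Phi E <= Phi F,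
      continuous_on_the_right Phi,
      Phi set0 = 0 &
      forall Q1 Q2, compact Q1 -> compact Q2 ->
        Phi Q1 + Phi Q2 = Phi (Q1 `|` Q2) + Phi (Q1 `&` Q2)].

Definition borel (T : topologicalType) : set (set T) := <<s @open T >>.

(* The axioms of [{measure set _ -> \bar R}], spelled out for the Borel sets:
   the library's measurable types carry a point, which would exclude the empty
   space. Values outside the Borel sets are irrelevant. *)
Definition borel_measure (R : realType) (T : topologicalType)
    (mu : set T -> \bar R) : Prop :=
  [/\ mu set0 = 0%E,
      forall B, borel B -> (0 <= mu B)%E &
      forall F : nat -> set T, (forall n, borel (F n)) -> trivIset setT F ->
        (fun n => \sum_(0 <= i < n) mu (F i))%E @ \oo --> mu (\bigcup_n F n)].

Lemma measure_borel_measure (R : realType) (T : ptopologicalType)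
    (mu : {measure set (g_sigma_algebraType (@open T)) -> \bar R}) :
  borel_measure (mu : set T -> \bar R).
Proof.
split; [exact: measure0 | by move=> B _; exact: measure_ge0 |].
move=> F mF tF.
apply: (@measure_semi_sigma_additive _ _ _ mu F) => //.
by apply: bigcup_measurable => n _; exact: mF.
Qed.

Definition radon_measure (R : realType) (T : topologicalType)
    (mu : set T -> \bar R) : Prop :=
  [/\ borel_measure mu,
      forall Q, compact Q -> (mu Q < +oo)%E,
      forall U, open U ->
        mu U = ereal_sup [set mu Q | Q in [set Q | compact Q /\ Q `<=` U]] &
      forall B, borel B ->
        mu B = ereal_inf [set mu U | U in [set U | open U /\ B `<=` U]]].

Section point_process.
Context (R : realType) (T : topologicalType) (d : measure_display)
  (Omega : measurableType d) (P : probability Omega R).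

(* [nat] carries the discrete sigma-algebra. *)
Definition point_process (N : set T -> {RV P >-> nat}) : Prop :=
  forall w : Omega, valuation (fun Q => (N Q w)%:R : R).

(* [fine] is harmless: [lambda] is finite on compact sets. *)
Definition general_poisson_process (N : set T -> {RV P >-> nat}) : Prop :=
  point_process N /\
  exists2 lambda : set T -> \bar R, radon_measure lambda &
    forall (k : nat) (Q : 'I_k -> set T) (n : 'I_k -> nat),
      (forall i, compact (Q i)) -> trivIset setT Q ->
      P [set w | forall i, N (Q i) w = n i] =
      (\prod_(i < k) (expR (- fine (lambda (Q i))) *
                      (fine (lambda (Q i)) ^+ n i / (n i)`!%:R)))%:E.

Definition is_zero_probability_function (N : set T -> {RV P >-> nat})
    (phi : set T -> R) : Prop :=
  forall Q, compact Q -> (phi Q)%:E = P [set w | N Q w = 0%N].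

End point_process.

(* Main.v *)
Require Import Defs.
From HB Require Import structures.
From mathcomp Require Import all_boot all_order all_algebra.
From mathcomp Require Import all_classical all_reals all_analysis.
From mathcomp Require Import measurable_realfun ring.
Set Implicit Arguments.
Unset Strict Implicit.
Unset Printing Implicit Defensive.
Import Order.TTheory GRing.Theory Num.Theory.
Import numFieldNormedType.Exports.
Local Open Scope classical_set_scope.
Local Open Scope ring_scope.

(* If N is a Poisson process with intensity lambda, then P(N(Q) = 0) is
   exp(- lambda Q), and the product identity is the modularity of lambda.

   Conversely psi = - ln phi is a valuation.  Its inner content on open sets
   induces an outer measure for which open sets are Caratheodory measurable, and
   right continuity makes it agree with psi on compact sets: this is a Radon
   measure lambda.  A Poisson process with intensity lambda is then built on the
   shells B_n = L_(n+1) \ L_n of an exhaustion of the space by compact sets L_n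
   whose interiors swallow every compact set: in each shell one throws a Poisson
   number of independent points, independently from shell to shell.  A compact
   set meets finitely many shells, so that every realization is locally finite,
   hence a valuation.  As the space need not be second countable, the underlying
   probability space is an abstract infinite product, for which countable
   additivity is proved by Saeki's argument. *)

(** * Infinite products of probability measures *)

(** Dependent choice for coordinates fixed one at a time: the approximations agree on ever longer
    prefixes, and since [P m] only looks at the first [m] coordinates, it passes to their limit. *)
Lemma exists_sequence_of_prefixes (S : Type) (P : nat -> (nat -> S) -> Prop) :
  (forall m x y, (forall i, (i < m)%N -> x i = y i) -> P m x -> P m y) ->
  (exists x, P 0%N x) ->
  (forall m x, P m x ->
     exists2 y, (forall i, (i < m)%N -> y i = x i) & P m.+1 y) ->
  exists x, forall m, P m x.
Proof.
move=> Ploc [x0 Px0] Pstep.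
have /choice[f fP] : forall mx : nat * (nat -> S), exists y : nat -> S,
    P mx.1 mx.2 -> (forall i, (i < mx.1)%N -> y i = mx.2 i) /\ P mx.1.+1 y.
  move=> [m x] /=; have [/Pstep[y yx Py]|nP] := pselect (P m x).
    by exists y.
  by exists x.
pose z := fix z m := if m is m'.+1 then f (m', z m') else x0.
have Pz m : P m (z m) by elim: m => //= m IH; case: (fP (m, z m) IH).
have zS m i : (i < m)%N -> z m.+1 i = z m i.
  by move=> im; case: (fP (m, z m) (Pz m)) => /(_ i im).
have zE i m : (i < m)%N -> z m i = z i.+1 i.
  elim: m => // m IH; rewrite ltnS leq_eqVlt => /predU1P[->//|im].
  by rewrite zS// IH.
(* Coordinate [i] is settled from stage [i.+1] on, so the limit is read along this diagonal. *)
exists (fun i => z i.+1 i) => m.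
by apply: Ploc (Pz m) => i im; rewrite zE.
Qed.

Definition box (S : Type) (F : nat -> set S) : set (nat -> S) :=
  [set x | forall i, F i (x i)].

Section boxes.
Context d (S : measurableType d).
Implicit Types F G : nat -> set S.

(** The depth is only an upper bound, so that boxes can be brought to a common depth. *)
Definition has_depth n F :=
  (forall i, measurable (F i)) /\ (forall i, (n <= i)%N -> F i = setT).

Lemma has_depth_le n m F : (n <= m)%N -> has_depth n F -> has_depth m F.
Proof. by move=> nm [mF FT]; split=> // i mi; apply/FT/(leq_trans nm). Qed.

Definition boxes : set (set (nat -> S)) :=
  [set A | exists n F, has_depth n F /\ A = box F].

Definition seq_space := nat -> S.

HB.instance Definition _ := Pointed.on seq_space.

Lemma boxes0 : boxes set0.
Proof.
exists 1%N, (fun i => if i is 0%N then set0 else setT); split.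
  by split=> [[|i]|[|i]]//=; exact: measurableT.
by apply/seteqP; split=> // x /(_ 0%N).
Qed.

Lemma boxI F G : box F `&` box G = box (fun i => F i `&` G i).
Proof.
apply/seteqP; split=> x; first by move=> [Fx Gx] i; split.
by move=> FG; split=> i; case: (FG i).
Qed.

Lemma has_depthI n m F G : has_depth n F -> has_depth m G ->
  has_depth (maxn n m) (fun i => F i `&` G i).
Proof.
move=> [mF FT] [mG GT]; split=> [i|i]; first exact: measurableI.
by rewrite geq_max => /andP[/FT-> /GT->]; rewrite setTI.
Qed.

Lemma boxesI : setI_closed boxes.
Proof.
move=> _ _ [n [F [nF ->]]] [m [G [mG ->]]]; rewrite boxI.
by exists (maxn n m), (fun i => F i `&` G i); split=> //; exact: has_depthI.
Qed.

Lemma boxesD : semi_setD_closed boxes.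
Proof.
move=> _ _ [n [F [nF ->]]] [m [G [mG ->]]].
wlog nm : n m nF mG / n = m.
  move=> /(_ (maxn n m) (maxn n m)); apply=> //.
  - by apply: has_depth_le nF; exact: leq_maxl.
  - by apply: has_depth_le mG; exact: leq_maxr.
rewrite {}nm in nF.
(* A point of [box F] outside [box G] is sorted by the first coordinate [i] at which it leaves [G]:
   this gives finitely many pairwise disjoint boxes. *)
pose H i j := if (j < i)%N then F j `&` G j
              else if j == i then F i `\` G i else F j.
have HD i x : box (H i) x -> box F x /\ ~ G i (x i).
  move=> Hx; split=> [j|]; last first.
    by have := Hx i; rewrite /H ltnn eqxx => -[].
  by have := Hx j; rewrite /H; case: ifP => _; [case|case: eqP => [->[]|]].
exists [set box (H i) | i in `I_m]; split.
- exact/finite_image/finite_II.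
- move=> _ [i im <-]; exists m, (H i); split=> //; split=> [j|j mj]; rewrite /H.
    case: ifP => _; first by apply: measurableI; [exact: nF.1|exact: mG.1].
    by case: ifP => _; [apply: measurableD; [exact: nF.1|exact: mG.1]|exact: nF.1].
  by rewrite ltnNge (ltnW (leq_trans im mj))/= gtn_eqF ?(leq_trans im mj)// nF.2.
- rewrite bigcup_image; apply/seteqP; split=> x; last first.
    move=> [i im /HD[Fx nGx]]; split=> // Gx; exact/nGx/Gx.
  move=> [Fx /existsNP nG].
  have exP : exists i, `[< ~ G i (x i) >] by case: nG => i ?; exists i; apply/asboolP.
  case: (ex_minnP exP) => i /asboolP nGi iP.
  exists i; first by rewrite /= ltnNge; apply/negP => /mG.2 GT; apply: nGi; rewrite GT.
  move=> j; rewrite /H; case: ltnP => ji.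
    split; first exact: Fx.
    by apply: contrapT => /asboolP/iP; rewrite leqNgt ji.
  by case: eqP => [->|_]; [split=> //; exact: Fx|exact: Fx].
- move=> _ _ [i _ <-] [j _ <-] [x [Hix Hjx]]; congr (box (H _)).
  wlog ij : i j Hix Hjx / (i <= j)%N.
    by case: (leqP i j) => [|/ltnW] ij /(_ _ _ _ _ ij); [apply|move=> E; apply/esym/E].
  move: ij; rewrite leq_eqVlt => /predU1P[//|ij].
  by have [_] := HD _ _ Hix; have := Hjx i; rewrite /H ij => -[].
Qed.

HB.instance Definition _ :=
  isSemiRingOfSets.Build d seq_space boxes0 boxesI boxesD.

End boxes.

Section integral_sections.
Context d (S : measurableType d) (R : realType) (mu : {measure set S -> \bar R}).
Local Open Scope ereal_scope.

Let integral_cst_indic (a : R) (E : set S) : measurable E -> (0 <= a)%R ->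
  \int[mu]_y (a * \1_E y)%:E = a%:E * mu E.
Proof.
move=> mE a0; under eq_integral do rewrite EFinM.
by rewrite ge0_integralZl_EFin ?integral_indic ?setIT//; apply/measurable_EFinP.
Qed.

Let measurable_cst_indic (a : R) (E : set S) : measurable E ->
  measurable_fun setT (fun y => (a * \1_E y)%:E).
Proof. by move=> mE; apply/measurable_EFinP; exact: measurable_funM. Qed.

(** If the reverse inequality held at every [y], integrating it, with sum and integral exchanged by
    nonnegativity, would contradict the hypothesis. *)
Lemma exists_section_lt (a : nat -> R) (a' : R) (E : nat -> set S) (E' : set S) :
  (forall k, 0 <= a k)%R -> (0 <= a')%R ->
  (forall k, measurable (E k)) -> measurable E' ->
  \sum_(k <oo) ((a k)%:E * mu (E k)) < a'%:E * mu E' ->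
  exists y, \sum_(k <oo) (a k * \1_(E k) y)%:E < (a' * \1_E' y)%:E.
Proof.
move=> a0 a'0 mE mE'; apply: contraPP => /forallNP H; apply/negP; rewrite -leNgt.
rewrite -integral_cst_indic//.
under eq_eseriesr do rewrite -integral_cst_indic//.
have nn k y : 0 <= (a k * \1_(E k) y)%:E by rewrite lee_fin mulr_ge0.
rewrite -integral_nneseries//; last by move=> k; exact: measurable_cst_indic.
apply: ge0_le_integral => //.
- by move=> y _; rewrite lee_fin mulr_ge0.
- exact: measurable_cst_indic.
- by apply: ge0_emeasurable_sum => // k _; exact: measurable_cst_indic.
- by move=> y _; have /negP := H y; rewrite -leNgt.
Qed.

Lemma exists_section_neq (a : nat -> R) (a' : R) (E : nat -> set S) (E' : set S) K :
  (forall k, 0 <= a k)%R -> (0 <= a')%R ->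
  (forall k, measurable (E k)) -> measurable E' ->
  \sum_(k < K) ((a k)%:E * mu (E k)) != a'%:E * mu E' ->
  exists y, (\sum_(k < K) a k * \1_(E k) y != a' * \1_E' y)%R.
Proof.
move=> a0 a'0 mE mE'; apply: contraPP => /forallNP H; apply/negP; rewrite negbK.
rewrite -integral_cst_indic//.
under eq_bigr do rewrite -integral_cst_indic//.
have nn k y : 0 <= (a k * \1_(E k) y)%:E by rewrite lee_fin mulr_ge0.
rewrite -(big_mkord xpredT (fun k => \int[mu]_y (a k * \1_(E k) y)%:E)).
rewrite -ge0_integral_sum//; last by move=> k; exact: measurable_cst_indic.
apply/eqP; apply: eq_integral => y _; have /negP := H y.
by rewrite negbK => /eqP <-; rewrite big_mkord sumEFin.
Qed.

End integral_sections.

Section box_mass.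
Context d (S : measurableType d) (R : realType) (mu : nat -> probability S R).
Implicit Types (F G : nat -> set S) (x y : nat -> S).

Definition mass n F : R := \prod_(0 <= i < n) fine (mu i (F i)).

(** Mass of the section of the box obtained by fixing the first [m] coordinates to those of [x]. For
    a box of depth [n] it interpolates between [mass n F] at [m = 0] and the indicator of the box
    once [m] reaches [n]. *)
Definition section_mass n F m x : R :=
  \prod_(0 <= i < m) \1_(F i) (x i) * \prod_(m <= i < n) fine (mu i (F i)).

Let section_mass_ge0 n F m x : 0 <= section_mass n F m x.
Proof.
by apply: mulr_ge0; apply: prodr_ge0 => i _; rewrite ?fine_ge0 ?indicE.
Qed.

Let indic_prod n F x : has_depth n F ->
  \prod_(0 <= i < n) \1_(F i) (x i) = \1_(box F) x :> R.
Proof.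
move=> [_ FT]; have [Fx|/existsNP[i nFi]] := pselect (box F x).
  rewrite indicE mem_set// big1 ?mulr1n// => i _.
  by rewrite indicE mem_set ?mulr1n//; exact: Fx.
rewrite [RHS]indicE memNset; last by move=> /(_ i).
have [ni|iltn] := leqP n i; first by exfalso; apply: nFi; rewrite FT.
rewrite (@bigD1_seq _ _ _ _ _ i) ?mem_index_iota ?iota_uniq//=.
by rewrite indicE memNset// mul0r.
Qed.

Let section_mass0 n F x : section_mass n F 0 x = mass n F.
Proof. by rewrite /section_mass big_geq// mul1r. Qed.

Let section_mass_ge n F m x : has_depth n F -> (n <= m)%N ->
  section_mass n F m x = \1_(box F) x.
Proof.
move=> nF nm; rewrite /section_mass [X in _ * X]big_geq// mulr1.
by rewrite indic_prod//; exact: has_depth_le nF.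
Qed.

Let section_mass_loc n F m x y : (forall i, (i < m)%N -> x i = y i) ->
  section_mass n F m x = section_mass n F m y.
Proof.
move=> xy; rewrite /section_mass; congr (_ * _).
by apply: eq_big_nat => i /andP[_ im]; rewrite xy.
Qed.

Let upd x m (s : S) : nat -> S := fun i => if i == m then s else x i.

Let section_mass_step n F m x : has_depth n F -> exists a : R,
  [/\ 0 <= a, (section_mass n F m x)%:E = (a%:E * mu m (F m))%E &
    forall s, section_mass n F m.+1 (upd x m s) = a * \1_(F m) s].
Proof.
move=> [mF FT].
(* The witness collects all factors but the [m]-th. When [n <= m] the missing factor is the mass 1
   of the whole space. *)
exists (\prod_(0 <= i < m) \1_(F i) (x i) * \prod_(m.+1 <= i < n) fine (mu i (F i))).
split=> [||s].
  by apply: mulr_ge0; apply: prodr_ge0 => i _; rewrite ?fine_ge0 ?measure_ge0 ?indicE.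
- rewrite -[X in (_ * X)%E]fineK ?fin_num_measure// -EFinM -mulrA; congr (_ * _)%:E.
  have [nm|mn] := leqP n m.
    by rewrite !big_geq ?(leqW nm)// FT// probability_setT mulr1.
  by rewrite [LHS]big_ltn// mulrC.
- rewrite /section_mass big_nat_recr//= /upd eqxx mulrAC; congr (_ * _ * _).
  by apply: eq_big_nat => i /andP[_ im]; rewrite ltn_eqF.
Qed.

Lemma mass_ge0 n F : 0 <= mass n F.
Proof. by apply: prodr_ge0 => i _; rewrite fine_ge0. Qed.

(* Saeki's argument: if the masses of the covering boxes added up to less than
   the mass of the covered one, coordinates could be fixed one after the other,
   each time keeping the strict inequality between the masses of the sections;
   the resulting sequence would lie in the covered box but in none of the
   covering ones. *)
Lemma mass_sigma_subadditive (n : nat -> nat) (F : nat -> nat -> set S) n' G :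
  (forall k, has_depth (n k) (F k)) -> has_depth n' G ->
  box G `<=` \bigcup_k box (F k) ->
  ((mass n' G)%:E <= \sum_(k <oo) (mass (n k) (F k))%:E)%E.
Proof.
move=> nF nG GF; rewrite leNgt; apply/negP => lt0.
pose P m x := (\sum_(k <oo) (section_mass (n k) (F k) m x)%:E <
               (section_mass n' G m x)%:E)%E.
have [|||x Px] := @exists_sequence_of_prefixes _ P.
- move=> m x y xy; rewrite /P (section_mass_loc _ _ xy).
  by under eq_eseriesr do rewrite (section_mass_loc _ _ xy).
- exists point; rewrite /P section_mass0.
  by under eq_eseriesr do rewrite section_mass0.
- move=> m x; rewrite /P => Pmx.
  have /choice[a aP] := fun k => section_mass_step m x (nF k).
  have aE k : (section_mass (n k) (F k) m x)%:E = ((a k)%:E * mu m (F k m))%E.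
    by case: (aP k).
  have as_ k s : section_mass (n k) (F k) m.+1 (upd x m s) = a k * \1_(F k m) s.
    by case: (aP k).
  have [a' [a'0 a'E a's]] := section_mass_step m x nG.
  have [|||||s Hs] := @exists_section_lt _ _ _ (mu m) a a' (fun k => F k m) (G m).
  + by move=> k; case: (aP k).
  + by [].
  + by move=> k; exact: (nF k).1.
  + exact: nG.1.
  + by rewrite -a'E; under eq_eseriesr do rewrite -aE; exact: Pmx.
  exists (upd x m s) => [i im|]; first by rewrite /upd ltn_eqF.
  by rewrite a's; under eq_eseriesr do rewrite as_.
(* At stage [n'] the target is an indicator exceeding a nonnegative sum, so [x] lies in [box G].
   Once the depth of a covering box containing [x] is also reached, that box alone contributes 1,
   which is already too much. *)
have [Gx|nGx] := pselect (box G x); last first.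
  have := Px n'; rewrite /P section_mass_ge// indicE memNset// ltNge.
  move/negP; apply; apply: nneseries_ge0 => k _ _.
  by rewrite lee_fin.
have [k _ Fkx] := GF _ Gx.
have := Px (maxn n' (n k)); rewrite /P section_mass_ge ?leq_maxl//.
rewrite ltNge => /negP; apply; apply: le_trans (nneseries_lim_ge k.+1 _).
  rewrite big_nat_recr//= section_mass_ge ?leq_maxr// !indicE !mem_set//.
  by apply: leeDr; apply: sume_ge0 => i _; rewrite lee_fin.
by move=> i _ _; rewrite lee_fin.
Qed.

(** The hypothesis on indicators says that the boxes partition [box G]. If the masses differed,
    coordinates could be fixed while keeping the section masses different, up to a depth common to
    all the boxes, where the section masses are these indicators. *)
Lemma mass_additive K (n : nat -> nat) (F : nat -> nat -> set S) n' G :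
  (forall k, has_depth (n k) (F k)) -> has_depth n' G ->
  (forall x, \sum_(k < K) \1_(box (F k)) x = \1_(box G) x :> R) ->
  \sum_(k < K) mass (n k) (F k) = mass n' G.
Proof.
move=> nF nG GF; apply/eqP; apply/negP => /negP neq0.
pose P m x := \sum_(k < K) section_mass (n k) (F k) m x != section_mass n' G m x.
have [|||x Px] := @exists_sequence_of_prefixes _ P.
- move=> m x y xy; rewrite /P (section_mass_loc _ _ xy).
  by under eq_bigr do rewrite (section_mass_loc _ _ xy).
- exists point; rewrite /P section_mass0.
  by under eq_bigr do rewrite section_mass0.
- move=> m x; rewrite /P => Pmx.
  have /choice[a aP] := fun k => section_mass_step m x (nF k).
  have aE k : (section_mass (n k) (F k) m x)%:E = ((a k)%:E * mu m (F k m))%E.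
    by case: (aP k).
  have as_ k s : section_mass (n k) (F k) m.+1 (upd x m s) = a k * \1_(F k m) s.
    by case: (aP k).
  have [a' [a'0 a'E a's]] := section_mass_step m x nG.
  have [|||||s Hs] := @exists_section_neq _ _ _ (mu m) a a' (fun k => F k m) (G m) K.
  + by move=> k; case: (aP k).
  + by [].
  + by move=> k; exact: (nF k).1.
  + exact: nG.1.
  + rewrite -a'E; under eq_bigr do rewrite -aE.
    by rewrite sumEFin eqe.
  exists (upd x m s) => [i im|]; first by rewrite /upd ltn_eqF.
  by rewrite a's; under eq_bigr do rewrite as_.
have := Px (maxn n' (\max_(k < K) n k)).
rewrite /P section_mass_ge ?leq_maxl// -GF; under eq_bigr => k _.
  rewrite section_mass_ge//; last first.
    by rewrite leq_max (leq_bigmax k) orbT.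
  over.
by rewrite eqxx.
Qed.

End box_mass.

Lemma sum_indic_trivIset (T : Type) (R : pzRingType) (F : nat -> set T) K x :
  trivIset [set: nat] F ->
  \sum_(k < K) \1_(F k) x = \1_(\big[setU/set0]_(k < K) F k) x :> R.
Proof.
move=> tF; elim: K => [|K IH]; first by rewrite !big_ord0 indic0.
rewrite !big_ord_recr/= IH !indicE in_setU.
have [] := boolP (x \in F K) => [/set_mem FKx|_]; last by rewrite orbF addr0.
rewrite memNset/= ?add0r// -bigcup_mkord => -[j /= jK Fjx].
have /eqP := tF j K I I (ex_intro _ x (conj Fjx FKx)).
by rewrite ltn_eqF.
Qed.

Section product_measure.
Context d (S : measurableType d) (R : realType) (mu : nat -> probability S R).
Local Open Scope ereal_scope.

(* The box presenting A is chosen arbitrarily, and is not unique if A is empty;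
   box_measureE shows that the choice does not matter. *)
Definition box_measure (A : set (seq_space S)) : \bar R :=
  if pselect (exists nF, has_depth nF.1 nF.2 /\ A = box nF.2) is left nF
  then (mass mu (projT1 (cid nF)).1 (projT1 (cid nF)).2)%:E else 0.

Lemma box_measureE n (F : nat -> set S) : has_depth n F ->
  box_measure (box F) = (mass mu n F)%:E.
Proof.
move=> nF; rewrite /box_measure; case: pselect => [e|[]]; last by exists (n, F).
case: cid => -[m G]/= [mG FG]; congr EFin.
(* Additivity for a family of one box compares two presentations of the same set. *)
have := @mass_additive _ _ _ mu 1 (fun=> m) (fun=> G) n F (fun=> mG) nF.
by rewrite big_ord1; apply=> x; rewrite big_ord1 FG.
Qed.

Let box_measure_ge0 A : 0 <= box_measure A.
Proof.
by rewrite /box_measure; case: pselect => // ?; rewrite lee_fin mass_ge0.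
Qed.

Let boxesP (F : nat -> set (seq_space S)) : (forall k, measurable (F k)) ->
  exists n, exists G, forall k, has_depth (n k) (G k) /\ F k = box (G k).
Proof.
move=> mF; have /choice[nG nGP] : forall k, exists nG : nat * (nat -> set S),
    has_depth nG.1 nG.2 /\ F k = box nG.2.
  by move=> k; have [n [G nG]] := mF k; exists (n, G).
by exists (fun k => (nG k).1), (fun k => (nG k).2).
Qed.

Let box_measure_semi_additive : measure_function.semi_additive box_measure.
Proof.
move=> F K mF tF [n' [G [nG FG]]]; rewrite FG (box_measureE nG).
have [n [H nH]] := boxesP mF.
under eq_bigr do rewrite (nH _).2 (box_measureE (nH _).1).
rewrite sumEFin; congr EFin; symmetry; apply: mass_additive => // [k|x].
  exact: (nH k).1.
rewrite -FG -sum_indic_trivIset//; apply: eq_bigr => k _.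
by rewrite (nH k).2.
Qed.

HB.instance Definition _ := isContent.Build _ (seq_space S) R box_measure
  box_measure_ge0 box_measure_semi_additive.

Let box_measure_sigma_subadditive : measurable_subset_sigma_subadditive box_measure.
Proof.
move=> A F mF [n' [G [nG ->]]] AF; rewrite (box_measureE nG).
have [n [H nH]] := boxesP mF.
under eq_eseriesr do rewrite (nH _).2 (box_measureE (nH _).1).
apply: mass_sigma_subadditive => // [k|]; first exact: (nH k).1.
by move=> x /AF[k _]; rewrite (nH k).2; exists k.
Qed.

HB.instance Definition _ := Content_SigmaSubAdditive_isMeasure.Build _ R
  (seq_space S) box_measure box_measure_sigma_subadditive.

Definition seq_measurableType := g_sigma_algebraType (@measurable _ (seq_space S)).

HB.instance Definition _ := Measurable.on seq_measurableType.

Definition product_measure : set seq_measurableType -> \bar R :=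
  measure_extension box_measure.

HB.instance Definition _ := Measure.on product_measure.

Lemma measurable_box n (F : nat -> set S) : has_depth n F ->
  measurable (box F : set seq_measurableType).
Proof. by move=> nF; apply: sub_sigma_algebra; exists n, F. Qed.

Lemma product_measure_box n (F : nat -> set S) : has_depth n F ->
  product_measure (box F) = (mass mu n F)%:E.
Proof.
move=> nF; rewrite -box_measureE//; apply: measurable_mu_extE.
by exists n, F.
Qed.

Let product_measure_setT : product_measure setT = 1.
Proof.
have dT : has_depth 0 (fun=> setT : set S) by split.
have -> : setT = box (fun=> setT : set S) by apply/seteqP; split.
by rewrite (product_measure_box dT) /mass big_geq.
Qed.

HB.instance Definition _ := Measure_isProbability.Build _ _ _ product_measure
  product_measure_setT.

End product_measure.

(** * Independence of coordinates *)

Section finite_unions.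
Context d (T : measurableType d) (R : realType) (mu : {measure set T -> \bar R}).

Lemma measure_bigcup_finType (J : finType) (A : J -> set T) :
  (forall j, measurable (A j)) -> trivIset setT A ->
  mu (\bigcup_j A j) = (\sum_j mu (A j))%E.
Proof.
move=> mA tA; have fJ : finite_set [set: J] by exact: finite_finset.
rewrite measure_fin_bigcup//.
rewrite fsbig_finite//=; apply: perm_big; apply: uniq_perm.
- exact: finmap.fset_uniq.
- exact: index_enum_uniq.
- move=> j; transitivity true; last exact/esym/mem_index_enum.
  by have := in_fset_set fJ j; rewrite in_setT.
Qed.

End finite_unions.

Section independence.
Context d (S : measurableType d) (R : realType) (mu : nat -> probability S R).
Notation P := (product_measure mu).
Implicit Types (A : set (seq_measurableType S)) (F : nat -> set S).
Local Open Scope ereal_scope.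

(* The boxes tested constrain only coordinates of index at least r: this is all
   the independence between the first r coordinates and the others that is
   needed, and it passes from one coordinate to the next. *)
Definition tail_indep r A := measurable A /\ forall n F, has_depth n F ->
  (forall i, (i < r)%N -> F i = setT) -> P (A `&` box F) = P A * P (box F).

Lemma tail_indepT r : tail_indep r setT.
Proof.
split=> [|n F _ _]; first exact: measurableT.
by rewrite setTI probability_setT mul1e.
Qed.

Lemma tail_indep0 r : tail_indep r set0.
Proof.
split=> [|n F _ _]; first exact: measurable0.
by rewrite set0I !measure0 mul0e.
Qed.

Let cylinder r (B : set S) : nat -> set S := fun i => if i == r then B else setT.

Let cylinderP r B : measurable B -> has_depth r.+1 (cylinder r B).
Proof.
move=> mB; split=> i; rewrite /cylinder; first by case: eqP.
by move=> ri; rewrite gtn_eqF.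
Qed.

Let box_cylinder r B : box (cylinder r B) = [set x | B (x r)].
Proof.
apply/seteqP; split=> x /=; first by move=> /(_ r); rewrite /cylinder eqxx.
by move=> Bx i; rewrite /cylinder; case: eqP => // ->.
Qed.

Lemma measurable_coordinate r B : measurable B ->
  measurable ([set x | B (x r)] : set (seq_measurableType S)).
Proof. by move=> mB; rewrite -box_cylinder; exact: measurable_box (cylinderP r mB). Qed.

Lemma product_measure_coordinate r B : measurable B ->
  P [set x | B (x r)] = mu r B.
Proof.
move=> mB; rewrite -box_cylinder (product_measure_box _ (cylinderP r mB)) /mass.
rewrite big_nat_recr//= big1_seq => [|i]; last first.
  rewrite mem_index_iota => /andP[_ ir].
  by rewrite /cylinder ltn_eqF// probability_setT.
by rewrite mul1r /cylinder eqxx fineK ?fin_num_measure.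
Qed.

Let product_measure_cylinderI r B n F : measurable B -> has_depth n F ->
  (forall i, (i < r.+1)%N -> F i = setT) ->
  P (box (cylinder r B) `&` box F) = mu r B * P (box F).
Proof.
move=> mB nF Fr; rewrite boxI.
rewrite -product_measure_coordinate// -box_cylinder.
(* At a common depth the masses multiply factor by factor; at each coordinate one of the two factors
   is the whole space. *)
have nF' := has_depth_le (leq_maxr r.+1 n) nF.
have nC := has_depth_le (leq_maxl r.+1 n) (cylinderP r mB).
have := has_depthI nC nF'; rewrite maxnn => nCF.
rewrite (product_measure_box _ nCF) (product_measure_box _ nC).
rewrite (product_measure_box _ nF') -EFinM /mass -big_split/=; congr EFin.
apply: eq_bigr => i _; rewrite /cylinder; case: eqP => [->|_].
  by rewrite Fr// setIT probability_setT/= mulr1.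
by rewrite setTI probability_setT/= mul1r.
Qed.

(** A cylinder over coordinate [r] meets a box constraining only later coordinates in a box
    constraining coordinates from [r] on, to which the independence of [A] applies. *)
Lemma tail_indep_coordinate r A B : measurable B -> tail_indep r A ->
  tail_indep r.+1 (A `&` [set x | B (x r)]) /\
  P (A `&` [set x | B (x r)]) = P A * mu r B.
Proof.
move=> mB [mA iA].
have PAB : P (A `&` [set x | B (x r)]) = P A * mu r B.
  rewrite -product_measure_coordinate// -box_cylinder (iA _ _ (cylinderP r mB))//.
  by move=> i ir; rewrite /cylinder ltn_eqF.
split=> //; split=> [|n F nF Fr].
  by apply: measurableI => //; exact: measurable_coordinate.
have nCF := has_depthI (cylinderP r mB) nF.
rewrite PAB -setIA -muleA -(product_measure_cylinderI mB nF Fr) -box_cylinder boxI.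
rewrite (iA _ _ nCF)// => i ir.
by rewrite /cylinder ltn_eqF// setTI Fr// ltnS ltnW.
Qed.

Lemma tail_indep_bigcup r (J : finType) (A : J -> set (seq_measurableType S)) :
  (forall j, tail_indep r (A j)) -> trivIset setT A -> tail_indep r (\bigcup_j A j).
Proof.
move=> iA tA; have mA j : measurable (A j) by case: (iA j).
split=> [|n F nF Fr]; first by apply: fin_bigcup_measurable.
rewrite setI_bigcupl !measure_bigcup_finType//.
- rewrite ge0_sume_distrl; last by move=> j _; exact: measure_ge0.
  by apply: eq_bigr => j _; case: (iA j) => _ /(_ _ _ nF Fr).
- by move=> j; apply: measurableI => //; exact: measurable_box nF.
- by move=> i j _ _ [x [[Aix _] [Ajx _]]]; apply: tA => //; exists x.
Qed.

(** Law of a statistic computed coordinate by coordinate: [E r v] is to be read as the event that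
    its value after [r] coordinates is [v], [J v] lists the disjoint ways in which the next
    coordinate can lead to [v], and [pre v j] is the value before. It serves both for the draws
    inside a shell and for the passage from shell to shell. *)
Lemma product_measure_recursion (V : Type) (J : V -> finType)
    (E : nat -> V -> set (seq_measurableType S)) (pre : forall v, J v -> V)
    (B : nat -> forall v, J v -> set S) :
  (forall v, E 0%N v = setT \/ E 0%N v = set0) ->
  (forall r v (j : J v), measurable (B r v j)) ->
  (forall r v, trivIset setT (B r v)) ->
  (forall r v, E r.+1 v = \bigcup_j (E r (pre v j) `&` [set x | B r v j (x r)])) ->
  forall r v, tail_indep r (E r v) /\
    P (E r.+1 v) = \sum_j P (E r (pre v j)) * mu r (B r v j).
Proof.
move=> E0 mB tB ES.
have tEB r v : trivIset setT (fun j => E r (pre v j) `&` [set x | B r v j (x r)]).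
  by move=> i j _ _ [x [[_ Bi] [_ Bj]]]; apply: (tB r v) => //; exists (x r).
have iE r v : tail_indep r (E r v).
  elim: r v => [v|r IH v].
    by case: (E0 v) => ->; [exact: tail_indepT|exact: tail_indep0].
  rewrite ES; apply: tail_indep_bigcup => // j.
  by case: (tail_indep_coordinate (mB r v j) (IH (pre v j))).
move=> r v; split=> //; rewrite ES measure_bigcup_finType//.
  by apply: eq_bigr => j _; case: (tail_indep_coordinate (mB r v j) (iE r (pre v j))).
move=> j; apply: measurableI; first by case: (iE r (pre v j)).
exact: measurable_coordinate.
Qed.

End independence.

(** * Poisson numbers of independent points *)

Section multinomial_weights.
Context (R : realType) (k : nat) (q : 'I_k -> R) (q0 : R).
Implicit Types (v : 'I_k -> nat) (M : nat).

(** Undoes one draw of type [c]. When [v c = 0] the truncated subtraction returns [v] itself, hence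
    the guards [0 < v c] below. *)
Definition decr v (c : 'I_k) : 'I_k -> nat := fun c' => (v c' - (c' == c))%N.

Lemma sum_decr v c : (0 < v c)%N -> (\sum_c' v c' = (\sum_c' decr v c c').+1)%N.
Proof.
move=> vc; rewrite (bigD1 c)//= [in RHS](bigD1 c)//= /decr eqxx subn1.
rewrite -addSn prednK//; congr addn; apply: eq_bigr => c' /negbTE ->.
by rewrite subn0.
Qed.

Definition multinomial_weight v : R := \prod_c (q c ^+ v c / (v c)`!%:R).

Lemma multinomial_weight_decr v c : (0 < v c)%N ->
  multinomial_weight (decr v c) * q c = multinomial_weight v * (v c)%:R.
Proof.
move=> vc; rewrite /multinomial_weight (bigD1 c)//= [in RHS](bigD1 c)//=.
under eq_bigr => c' /negbTE nc do rewrite /decr nc subn0.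
rewrite /decr eqxx subn1; case: (v c) vc => // n _ /=.
have fn0 : n`!%:R != 0 :> R by rewrite pnatr_eq0 -lt0n fact_gt0.
have n0 : n.+1%:R != 0 :> R by [].
rewrite factS natrM exprS; set p := \prod_(_ < _ | _) _.
rewrite [RHS]mulrAC [LHS]mulrAC; congr (_ * p).
by move: n.+1%:R n`!%:R n0 fn0 => x y x0 y0; field; rewrite x0 y0.
Qed.

(** The multinomial formula for [M] draws containing [v c] of each type [c], the others having
    weight [q0]. The falling factorial stands for a quotient of factorials and makes the value 0
    when the counts add up to more than [M]. *)
Definition multinomial_pmf M v : R :=
  (M ^_ (\sum_c v c))%:R * q0 ^+ (M - \sum_c v c) * multinomial_weight v.

Lemma multinomial_pmf0 v : multinomial_pmf 0 v = (\sum_c v c == 0)%N%:R.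
Proof.
rewrite /multinomial_pmf sub0n expr0 mulr1.
have [s0|] := eqVneq (\sum_c v c)%N 0%N; last first.
  by case: (\sum_c v c)%N => // n _; rewrite ffact0n mul0r.
rewrite s0 ffactn0 mul1r /multinomial_weight big1// => c _.
move/eqP: s0; rewrite sum_nat_eq0 => /forallP/(_ c)/= /eqP ->.
by rewrite expr0 fact0 divr1.
Qed.

(** Conditioning on the last draw. The sum over its type produces a factor [\sum_c v c], and what
    remains is the Pascal rule for falling factorials. *)
Lemma multinomial_pmfS M v : multinomial_pmf M.+1 v =
  multinomial_pmf M v * q0 +
  \sum_c multinomial_pmf M (decr v c) * (if (0 < v c)%N then q c else 0).
Proof.
have -> : \sum_c multinomial_pmf M (decr v c) * (if (0 < v c)%N then q c else 0) =
    ((\sum_c v c) * M ^_ (\sum_c v c).-1)%:R * q0 ^+ (M.+1 - \sum_c v c) *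
    multinomial_weight v.
  rewrite big_distrl/= natr_sum !mulr_suml; apply: eq_bigr => c _.
  case: ifPn => [vc|]; last by rewrite -eqn0Ngt => /eqP ->; rewrite mul0n mulr0 !mul0r.
  rewrite /multinomial_pmf -[LHS]mulrA multinomial_weight_decr//.
  by rewrite (sum_decr vc)/= subSS natrM; ring.
rewrite /multinomial_pmf; case: (\sum_c v c)%N => [|s].
  by rewrite !ffactn0 mul0n !subn0 exprS !mul0r addr0; ring.
rewrite subSS /= [X in _ = X + _]mulrAC -mulrDl; congr (_ * _); rewrite ffactSS ffactnSr.
(* If [M <= s], the factor [M - s] kills the first term, and [M ^_ s] vanishes unless [M = s]. *)
have [sM|Ms] := ltnP s M.
  rewrite -mulrA -exprSr subnSK// -mulrDl -natrD; congr (_%:R * _).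
  by rewrite mulnC [(s.+1 * _)%N]mulnC -mulnDr addnS subnK// ltnW.
rewrite (eqP (_ : M - s == 0)%N) ?subn_eq0// muln0 !mul0r add0r expr0 !mulr1.
congr (_%:R); have [->//|] := eqVneq M s => Msn.
by rewrite ffact_small ?muln0// ltn_neqAle Msn.
Qed.

End multinomial_weights.

Lemma big_option (R : Type) (idx : R) (op : Monoid.com_law idx) (I : finType)
  (F : option I -> R) :
  \big[op/idx]_j F j = op (F None) (\big[op/idx]_i F (Some i)).
Proof.
rewrite (bigD1 None)//=; congr (op _ _).
by rewrite (reindex_omap Some id)//=; [apply: eq_bigl => i; rewrite eqxx|case].
Qed.

Section counting.
Context d (S : measurableType d) (R : realType) (rho : probability S R)
  (k : nat) (A : 'I_k -> set S).
Hypotheses (mA : forall c, measurable (A c)) (tA : trivIset setT A).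
Notation P := (product_measure (fun=> rho)).

Definition count_event M (v : 'I_k -> nat) : set (seq_measurableType S) :=
  [set x | forall c, (\sum_(j < M) (x j \in A c) = v c)%N].

(** [None] is a draw outside every [A c], which changes no count. *)
Let pre (v : 'I_k -> nat) (j : option 'I_k) :=
  if j is Some c then decr v c else v.

(** If [v c = 0], the last draw cannot have been of type [c], hence the empty set. *)
Let B (M : nat) (v : 'I_k -> nat) (j : option 'I_k) : set S :=
  if j is Some c then (if (0 < v c)%N then A c else set0)
  else ~` \bigcup_c A c.

Let count_eventS M v :
  count_event M.+1 v =
  \bigcup_j (count_event M (pre v j) `&` [set x | B M v j (x M)]).
Proof.
apply/seteqP; split=> [x xv|x [[c|] _ [/= xv]]].
- have [[c _ Ac]|nA] := pselect ((\bigcup_c A c) (x M)); last first.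
    exists None => //; split=> //= c; rewrite -xv big_ord_recr/= memNset ?addn0//.
    by move=> Ac; apply: nA; exists c.
  have xc c' : (x M \in A c') = (c' == c).
    apply/idP/eqP => [/set_mem Ac'|->]; last exact: mem_set.
    by apply: tA => //; exists (x M).
  exists (Some c) => //; split=> [c'|] /=.
    by rewrite /decr -xv big_ord_recr/= xc addnK.
  by rewrite -xv big_ord_recr/= xc eqxx addn1.
- case: ifPn => // vc Ac c'; rewrite big_ord_recr/= xv /decr.
  suff -> : (x M \in A c') = (c' == c).
    by have [->|] := eqVneq c' c; [rewrite subnK|rewrite subn0 addn0].
  apply/idP/eqP => [/set_mem Ac'|->]; last exact: mem_set.
  by apply: tA => //; exists (x M).
- move=> nA c; rewrite big_ord_recr/= xv memNset ?addn0//.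
  by move=> Ac; apply: nA; exists c.
Qed.

Let q c : R := fine (rho (A c)).
Let q0 : R := fine (rho (~` \bigcup_c A c)).

Lemma sum_types : fine (rho (~` \bigcup_c A c)) + \sum_c fine (rho (A c)) = 1.
Proof.
have mU : measurable (\bigcup_c A c) by apply: fin_bigcup_measurable.
have /(congr1 fine) := probability_setC rho mU.
rewrite measure_bigcup_finType// => ->.
rewrite (_ : (\sum_c rho (A c))%E = (\sum_c q c)%:E) ?subrK//.
by rewrite -sumEFin; apply: eq_bigr => c _; rewrite fineK// fin_num_measure.
Qed.

(** By induction on [M]: the recursion of the events in [count_eventS] is that of the formula in
    [multinomial_pmfS]. *)
Lemma count_event_law M v : measurable (count_event M v) /\
  P (count_event M v) = (multinomial_pmf q q0 M v)%:E.
Proof.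
have E0 u : count_event 0 u = setT \/ count_event 0 u = set0.
  have [u0|nu0] := pselect (forall c, u c = 0%N); [left|right].
    by apply/seteqP; split=> // x _ c; rewrite big_ord0 u0.
  apply/seteqP; split=> // x xu; apply: nu0 => c.
  by rewrite -(xu c) big_ord0.
have mB r u j : measurable (B r u j).
  case: j => [c|] /=; first by case: ifP.
  by apply: measurableC; apply: fin_bigcup_measurable.
have tB r u : trivIset setT (B r u).
  move=> [c|] [c'|] _ _ //=.
  - do 2 case: ifP => _; rewrite ?set0I ?setI0; try by move=> [].
    by move=> cc'; congr Some; exact: tA.
  - by case: ifP => _ [x [Ax []]] => // ; exists c.
  - by case: ifP => _ [x [nAx Ax]] => //; exfalso; apply: nAx; exists c'.
have rec := product_measure_recursion (fun=> rho) E0 mB tB count_eventS.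
split; first by case: (rec M v) => -[].
elim: M v => [|M IH] v.
  rewrite multinomial_pmf0; have [/eqP|] := eqVneq.
    rewrite sum_nat_eq0 => /forallP v0.
    rewrite [X in P X](_ : _ = setT) ?probability_setT//.
    by apply/seteqP; split=> // x _ c; rewrite big_ord0; apply/esym/eqP/v0.
  move=> v0; rewrite [X in P X](_ : _ = set0) ?measure0//.
  apply/seteqP; split=> // x xv; move/negP: v0; apply.
  by rewrite sum_nat_eq0; apply/forallP => c; rewrite /= -(xv c) big_ord0.
case: (rec M v) => _ ->; rewrite big_option/= IH multinomial_pmfS EFinD.
rewrite [X in _ = (X + _)%E]EFinM.
rewrite /q0 fineK ?fin_num_measure//; last exact: (mB 0%N v None).
congr (_ + _)%E; rewrite -sumEFin; apply: eq_bigr => c _; rewrite IH [RHS]EFinM.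
by case: ifPn => vc; rewrite ?measure0// /q fineK// fin_num_measure.
Qed.

End counting.

Definition poisson_weight (R : realType) (a : R) (n : nat) : R :=
  expR (- a) * (a ^+ n / n`!%:R).

Lemma nneseries_expR (R : realType) (x : R) : 0 <= x ->
  (\sum_(n <oo) (x ^+ n / n`!%:R)%:E = (expR x)%:E)%E.
Proof.
move=> x0; rewrite expRE -EFin_lim; last first.
  rewrite /pseries/=; under eq_fun do rewrite mulrC.
  exact: is_cvg_series_exp_coeff.
apply/congr_lim/funext => n/=; rewrite /pseries/= /series/= -sumEFin//.
by under [in RHS]eq_bigr do rewrite mulrC.
Qed.

(** The terms with [M < s] vanish. After a shift by [s] the falling factorial cancels against the
    factorial of [M], and the exponential series of [a * x] remains. *)
Lemma nneseries_poisson_ffact (R : realType) (a x : R) (s : nat) :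
  0 <= a -> 0 <= x ->
  (\sum_(M <oo) (a ^+ M / M`!%:R * ((M ^_ s)%:R * x ^+ (M - s)))%:E =
   (a ^+ s * expR (a * x))%:E)%E.
Proof.
move=> a0 x0; pose F M : \bar R := (a ^+ M / M`!%:R * ((M ^_ s)%:R * x ^+ (M - s)))%:E.
rewrite -[LHS]/(\sum_(M <oo) F M)%E.
have F0 n : (0 <= F n)%E.
  rewrite lee_fin; apply: mulr_ge0; [apply: divr_ge0|apply: mulr_ge0] => //;
    exact: exprn_ge0.
rewrite (nneseries_split _ s)//= big1_seq ?add0e; last first.
  move=> M; rewrite mem_index_iota => /andP[_ Ms].
  by rewrite /F ffact_small// mul0r mulr0.
rewrite add0n -(nneseries_addn s)//.
under eq_eseriesr => m _.
  rewrite /F addnK (_ : _ * _ = a ^+ s * ((a * x) ^+ m / m`!%:R)); last first.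
    have -> : ((m + s) `!%:R : R) = ((m + s) ^_ s)%:R * m`!%:R.
      by rewrite -(ffact_fact (leq_addl m s)) addnK natrM.
    have f0 : m`!%:R != 0 :> R by rewrite pnatr_eq0 -lt0n fact_gt0.
    have g0 : ((m + s) ^_ s)%:R != 0 :> R.
      by rewrite pnatr_eq0 -lt0n ffact_gt0 leq_addl.
    move: (_ ^_ _)%:R m`!%:R f0 g0 => u w w0 u0.
    by rewrite exprD exprMn; field; rewrite u0 w0.
  rewrite EFinM.
  over.
rewrite nneseriesZl/=; last first.
  by move=> n _; rewrite lee_fin divr_ge0// exprn_ge0// mulr_ge0.
by rewrite nneseries_expR ?mulr_ge0// EFinM.
Qed.

Section level.
Context d (S : measurableType d) (R : realType) (rho : probability S R) (a : R).
Hypothesis a0 : 0 < a.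

(** The data of one shell: a number of points and an infinite sequence of draws, of which only the
    first [w.1] are counted. *)
Definition level_space : Type := (nat * seq_measurableType S)%type.

HB.instance Definition _ := Measurable.on level_space.

(* The second argument of poisson_prob is a dummy. *)
Definition level_measure : probability level_space R :=
  (poisson_prob a 0 \x product_measure (fun=> rho))%E.

Definition hits (A : set S) (w : level_space) : nat :=
  (\sum_(j < w.1) (w.2 j \in A))%N.

(** Splitting of a Poisson number of points: given their number [M], the counts are multinomial, and
    summing over [M] leaves the factor [expR (- a + a * q0)], which splits over the types because
    [q0] and the [q c] add up to 1. *)
Lemma level_law (k : nat) (A : 'I_k -> set S) (v : 'I_k -> nat) :
  (forall c, measurable (A c)) -> trivIset setT A ->
  measurable [set w | forall c, hits (A c) w = v c] /\
  level_measure [set w | forall c, hits (A c) w = v c] =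
    (\prod_c poisson_weight (a * fine (rho (A c))) (v c))%:E.
Proof.
move=> mA tA; have law M := count_event_law rho mA tA M v.
have evE : [set w | forall c, hits (A c) w = v c] =
    \bigcup_M ([set M] `*` count_event A M v).
  apply/seteqP; split=> [[M x] H|[M x] [_ _ [/= -> H]]] //.
  by exists M.
have mev M : measurable ([set M] `*` count_event A M v : set level_space).
  by apply: measurableX => //; case: (law M).
rewrite evE; split; first exact: bigcup_measurable.
rewrite measure_bigcup//; last first.
  by move=> M M' _ _ [[m x] [[/= -> _] [/= -> _]]].
set q := fun c => fine (rho (A c)); set q0 := fine (rho (~` \bigcup_c A c)).
have q00 : 0 <= q0 by exact: fine_ge0.
have qE : q0 + \sum_c q c = 1 by exact: sum_types.
transitivity (\sum_(M <oo) ((expR (- a) * multinomial_weight q v)%:E *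
  (a ^+ M / M`!%:R * ((M ^_ (\sum_c v c))%:R * q0 ^+ (M - \sum_c v c)))%:E))%E.
  rewrite (eq_eseriesl (Q := xpredT)); last by move=> M; rewrite in_setT.
  apply: eq_eseriesr => M _; rewrite [LHS](_ : _ = poisson_prob a 0 [set M] *
      product_measure (fun=> rho) (count_event A M v))%E; last first.
    by apply: product_measure1E => //; case: (law M).
  case: (law M) => _ ->; rewrite /poisson_prob a0 esum_set1; last first.
    by rewrite lee_fin poisson_pmf_ge0.
  rewrite -!EFinM /poisson_pmf a0 /multinomial_pmf -/q -/q0; congr EFin; ring.
have w0 : 0 <= multinomial_weight q v.
  apply: prodr_ge0 => c _; apply: divr_ge0 => //; apply: exprn_ge0; exact: fine_ge0.
rewrite nneseriesZl/=; last first.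
  move=> n _; rewrite lee_fin; apply: mulr_ge0.
    by apply: divr_ge0 => //; apply: exprn_ge0; exact: ltW.
  by apply: mulr_ge0 => //; exact: exprn_ge0.
rewrite nneseries_poisson_ffact ?(ltW a0)// -EFinM; congr EFin.
have -> : \prod_c poisson_weight (a * q c) (v c) =
    expR (- \sum_c a * q c) * (a ^+ (\sum_c v c) * multinomial_weight q v).
  rewrite -sumrN expR_sum -prodrXr /multinomial_weight -!big_split/=.
  by apply: eq_bigr => c _; rewrite /poisson_weight exprMn; ring.
have -> : - (\sum_c a * q c) = - a + a * q0.
  by rewrite -mulr_sumr; have -> : q0 = 1 - \sum_c q c; [rewrite -qE addrK|ring].
by rewrite expRD; ring.
Qed.

End level.

Lemma poisson_weight0 (R : realType) n : poisson_weight (0 : R) n = (n == 0)%N%:R.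
Proof.
rewrite /poisson_weight oppr0 expR0 mul1r; case: n => [|n].
  by rewrite expr0 fact0 divr1.
by rewrite expr0n mul0r.
Qed.

(** Convolution of two Poisson laws, which is the binomial theorem. *)
Lemma poisson_weightD (R : realType) (a b : R) n :
  poisson_weight (a + b) n =
  \sum_(u < n.+1) poisson_weight a (n - u) * poisson_weight b u.
Proof.
rewrite /poisson_weight exprDn mulr_suml mulr_sumr opprD expRD.
apply: eq_bigr => i _.
have -> : a ^+ (n - i) * b ^+ i *+ 'C(n, i) / n`!%:R =
    a ^+ (n - i) / (n - i)`!%:R * (b ^+ i / i`!%:R).
  have ni : (i <= n)%N by rewrite -ltnS.
  have := congr1 (fun m => m%:R : R) (bin_fact ni); rewrite !natrM.
  have neq0 m : m`!%:R != 0 :> R by rewrite pnatr_eq0 -lt0n fact_gt0.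
  rewrite -(mulr_natr (_ * _)); move: (a ^+ _) (b ^+ _) => A B.
  move: (neq0 n) (neq0 i) (neq0 (n - i)%N) => + + + binE.
  move: binE; move: n`!%:R i`!%:R (n - i)`!%:R 'C(n, i)%:R => x y z c <- + y0 z0.
  rewrite mulf_eq0 !negb_or => /andP[c0 _]. by field; rewrite c0 y0 z0.
by rewrite mulrACA.
Qed.

Section levels.
Context d (S : measurableType d) (R : realType) (rho : nat -> probability S R)
  (a : nat -> R).
Hypothesis a0 : forall n, 0 < a n.
Notation P := (product_measure (fun n => level_measure (rho n) (a n))).

(** Superposition, by induction on the number of levels: the counts of a new level are independent
    of the previous ones, and the parameters add up by [poisson_weightD]. *)
Lemma levels_law (k : nat) (A : 'I_k -> nat -> set S) (r : nat) (v : 'I_k -> nat) :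
  (forall c n, measurable (A c n)) -> (forall n, trivIset setT (A ^~ n)) ->
  let E := [set w : seq_measurableType (level_space S) |
            forall c, (\sum_(n < r) hits (A c n) (w n))%N = v c] in
  measurable E /\
  P E = (\prod_c poisson_weight (\sum_(n < r) a n * fine (rho n (A c n))) (v c))%:E.
Proof.
move=> mA tA.
pose E r (v : 'I_k -> nat) : set (seq_measurableType (level_space S)) :=
  [set w | forall c, (\sum_(n < r) hits (A c n) (w n))%N = v c].
(* [J v] lists the counts that the last level may contribute. The bound [\sum_c v c], common to all
   [c], gives a single finite function type; [B] discards the vectors that are not below [v]. *)
pose J (v : 'I_k -> nat) : finType := {ffun 'I_k -> 'I_(\sum_c v c).+1}.
pose pre v (u : J v) : 'I_k -> nat := fun c => (v c - u c)%N.
pose B r v (u : J v) : set (level_space S) :=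
  if [forall c, (u c <= v c)%N] then [set w | forall c, hits (A c r) w = u c] else set0.
have law n (u : 'I_k -> nat) := level_law (rho n) (a0 n) u (mA ^~ n) (tA n).
have E0 u : E 0%N u = setT \/ E 0%N u = set0.
  have [u0|nu0] := pselect (forall c, u c = 0%N); [left|right].
    by apply/seteqP; split=> // x _ c; rewrite big_ord0 u0.
  apply/seteqP; split=> // x xu; apply: nu0 => c.
  by rewrite -(xu c) big_ord0.
have mB n u (j : J u) : measurable (B n u j).
  rewrite /B; case: ifP => // _; exact: (law n (fun c => j c)).1.
have tB n u : trivIset setT (B n u).
  move=> i j _ _ [w []]; rewrite /B; case: ifP => // _; case: ifP => // _ /= Hi Hj.
  by apply/ffunP => c; apply/val_inj; rewrite /= -Hi -Hj.
have ES n u : E n.+1 u = \bigcup_j (E n (pre u j) `&` [set w | B n u j (w n)]).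
  apply/seteqP; split=> [w wu|w [j _ [wj]]].
    have le c : (hits (A c n) (w n) <= u c)%N by rewrite -wu big_ord_recr/= leq_addl.
    have lt c : (hits (A c n) (w n) < (\sum_c u c).+1)%N.
      by rewrite ltnS (leq_trans (le c))// (bigD1 c)//= leq_addr.
    exists [ffun c => Ordinal (lt c)] => //; split=> [c|/=].
      by rewrite /pre ffunE/= -wu big_ord_recr/= addnK.
    rewrite /B; case: ifPn => [_ c|/forallPn[c]]; rewrite ffunE//=.
    by rewrite le.
  rewrite /= /B; case: ifP => // /forallP jle /= Hj c.
  by rewrite big_ord_recr/= wj Hj /pre subnK.
have rec := product_measure_recursion (fun n => level_measure (rho n) (a n)) E0 mB tB ES.
rewrite /= -/(E r v); split; first by case: (rec r v) => -[].
elim: r v => [|r IH] v.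
  under eq_bigr do rewrite big_ord0 poisson_weight0.
  have [v0|] := pselect (forall c, v c = 0%N).
    rewrite big1 => [|c _]; last by rewrite v0.
    rewrite [X in P X](_ : _ = setT) ?probability_setT//.
    by apply/seteqP; split=> // x _ c; rewrite big_ord0 v0.
  move=> nv0; have [c vc] := (existsNP _).2 nv0.
  rewrite (bigD1 c)//= (introF eqP vc) mul0r.
  rewrite [X in P X](_ : _ = set0) ?measure0//.
  by apply/seteqP; split=> // x /(_ c); rewrite big_ord0 => /esym.
case: (rec r v) => _ ->.
under [in RHS]eq_bigr do rewrite big_ord_recr/=.
set al := fun c => \sum_(n < r) a n * fine (rho n (A c n)) in IH *.
set be := fun c => a r * fine (rho r (A c r)).
transitivity (\sum_(j : J v) (\prod_c (if (j c <= v c)%N then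
    poisson_weight (al c) (v c - j c) * poisson_weight (be c) (j c) else 0))%:E)%E.
  apply: eq_bigr => j _; rewrite IH /B; case: ifPn => [/forallP jle|/forallPn[c jc]].
    rewrite (law r (fun c => j c)).2 -EFinM -big_split/=; congr EFin.
    by apply: eq_bigr => c _; rewrite jle.
  by rewrite measure0 mule0 (bigD1 c)//= (negbTE jc) mul0r.
rewrite sumEFin; congr EFin.
(* A sum over vectors of a product over [c] is a product of sums: one convolution for each [c]. *)
rewrite -(bigA_distr_bigA (fun c (j : 'I_(\sum_c v c).+1) => if (j <= v c)%N then
  poisson_weight (al c) (v c - j) * poisson_weight (be c) j else 0)).
apply: eq_bigr => c _; rewrite -big_mkcond/= poisson_weightD.
have vc : (v c < (\sum_c v c).+1)%N by rewrite ltnS (bigD1 c)//= leq_addr.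
rewrite (big_ord_widen _
  (fun u => poisson_weight (al c) (v c - u) * poisson_weight (be c) u) vc).
by apply: eq_bigl => u; rewrite ltnS.
Qed.

End levels.

(** * Radon measures from valuations *)

Section locally_compact_hausdorff.
Context (T : topologicalType).
Hypotheses (lcT : locally_compact [set: T]) (hT : hausdorff_space T).

Lemma compact_nbhs (K : set T) : compact K ->
  exists2 V, compact V & K `<=` V°.
Proof.
move=> /compact_near_coveringP cK.
(* Moving along [F] means taking ever larger compact sets; finite unions of compact sets make it a
   filter. *)
pose F := filter_from compact (fun V : set T => [set W | compact W /\ V `<=` W]).
have FF : Filter F.
  apply: filter_from_filter; first by exists set0; exact: compact0.
  move=> V W cV cW; exists (V `|` W); first exact: compactU.
  by move=> X [cX]; rewrite subUset => -[VX WX].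
have [x Kx|V cV VK] := cK _ F (fun W => W°) FF.
  have [U wU [cU _]] := lcT (I : setT x).
  have Ux : nbhs x U by apply: filterS (wU : nbhs x [set y | setT y -> U y]) => y; apply.
  exists (U°, [set W | compact W /\ U `<=` W]) => /=.
    by split; [exact: nbhs_interior|exists U].
  by move=> [y W] [/= Uy [_ UW]]; exact: interiorS Uy.
by exists V => //; apply: VK; split.
Qed.

(** [K \ U] and [K \ V] are disjoint and closed, so normality inside a compact neighbourhood of [K]
    yields an open [C] around the first and a [B] containing [C] whose closure misses the second.
    The pieces are [K] outside [C] and [K] inside the closure of [B]. *)
Lemma compact_split (K U V : set T) : compact K -> open U -> open V ->
  K `<=` U `|` V -> exists K1 K2,
  [/\ compact K1, compact K2, K1 `<=` U, K2 `<=` V & K = K1 `|` K2].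
Proof.
move=> cK oU oV KUV; have clK := compact_closed hT cK.
have [W cW KW] := compact_nbhs cK.
have clKU : closed (K `\` U) by apply: closedI => //; exact: open_closedC.
have clKV : closed (K `\` V) by apply: closedI => //; exact: open_closedC.
have [||B /set_nbhsP[C [oC AC CB]] Bcl] :=
    compact_normal_local hT cW _ clKU (t := ~` (K `\` V)).
- by move=> x [/KW].
- apply/set_nbhsP; exists (~` (K `\` V)); split=> //; first exact: closed_openC.
  by move=> x [Kx nUx] [_ nVx]; have [] := KUV _ Kx.
exists (K `\` C), (K `&` closure B); split.
- by apply: compact_closedI => //; exact: open_closedC.
- by apply: compact_closedI => //; exact: closed_closure.
- by move=> x [Kx nCx]; apply: contrapT => nUx; exact/nCx/AC.
- by move=> x [Kx /Bcl nKVx]; apply: contrapT => nVx; exact: nKVx.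
- rewrite setDE -setIUr; apply/esym/setIidPl => x Kx.
  have [Cx|] := pselect (C x); last by left.
  by right; apply: subset_closure; exact: CB.
Qed.

Lemma compact_initial_cover (K : set T) (U : nat -> set T) : compact K ->
  (forall n, open (U n)) -> K `<=` \bigcup_n U n ->
  exists n, K `<=` \big[setU/set0]_(i < n) U i.
Proof.
move=> /compact_near_coveringP cK oU KU.
have [x /KU[i _ Uix]|n _ Hn] :=
    cK nat \oo (fun n => \big[setU/set0]_(i < n) U i) _; last first.
  by exists n; apply: Hn => /=.
exists (U i, [set n | (i < n)%N]) => /=.
  by split; [exact: open_nbhs_nbhs|exact: nbhs_infty_gt].
by move=> [y n] [/= Uiy iltn]; rewrite -bigcup_mkord; exists i.
Qed.

End locally_compact_hausdorff.

Section radon_extension.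
Context (R : realType) (T : topologicalType).
Hypotheses (lcT : locally_compact [set: T]) (hT : hausdorff_space T).
Variable psi : set T -> R.
Hypothesis psi_val : valuation psi.
Local Open Scope ereal_scope.

Let psi_ge0 Q : compact Q -> (0 <= psi Q)%R.
Proof. by case: psi_val => + _ _ _ _; apply. Qed.
Let psi_le E F : compact E -> compact F -> E `<=` F -> (psi E <= psi F)%R.
Proof. by case: psi_val => _ + _ _ _; apply. Qed.
Let psi_cont : continuous_on_the_right psi. Proof. by case: psi_val. Qed.
Let psi0 : psi set0 = 0%R. Proof. by case: psi_val. Qed.
Let psi_mod Q1 Q2 : compact Q1 -> compact Q2 ->
  (psi Q1 + psi Q2 = psi (Q1 `|` Q2) + psi (Q1 `&` Q2))%R.
Proof. by case: psi_val => _ _ _ _; apply. Qed.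

Let compactI (A B : set T) : compact A -> compact B -> compact (A `&` B).
Proof. by move=> cA cB; apply: compact_closedI => //; exact: compact_closed. Qed.

Let psiU Q1 Q2 : compact Q1 -> compact Q2 ->
  (psi (Q1 `|` Q2) <= psi Q1 + psi Q2)%R.
Proof. by move=> c1 c2; rewrite psi_mod// lerDl psi_ge0//; exact: compactI. Qed.

Definition inner_content (U : set T) : \bar R :=
  ereal_sup [set (psi K)%:E | K in [set K | compact K /\ K `<=` U]].

Definition outer_content (A : set T) : \bar R :=
  ereal_inf [set inner_content U | U in [set U | open U /\ A `<=` U]].

Let inner_ub (U K : set T) : compact K -> K `<=` U -> (psi K)%:E <= inner_content U.
Proof. by move=> cK KU; apply: ereal_sup_ubound; exists K. Qed.

Let inner_le (U V : set T) : U `<=` V -> inner_content U <= inner_content V.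
Proof.
move=> UV; apply: ge_ereal_sup => _ [K [cK KU] <-].
by apply: inner_ub => //; exact: subset_trans UV.
Qed.

Let inner_ge0 U : 0 <= inner_content U.
Proof.
rewrite -[X in X <= _]/(0%R%:E) -psi0.
by apply: inner_ub => //; exact: compact0.
Qed.

Let outer_ge0 A : 0 <= outer_content A.
Proof. by apply: le_ereal_inf_tmp => _ [U _ <-]. Qed.

Let outer_le : {homo outer_content : A B / A `<=` B >-> A <= B}.
Proof.
move=> A B AB; apply: le_ereal_inf_tmp => _ [U [oU BU] <-].
by apply: ereal_inf_lbound; exists U => //; split=> //; exact: subset_trans BU.
Qed.

Let outer_open U : open U -> outer_content U = inner_content U.
Proof.
move=> oU; apply/eqP; rewrite eq_le; apply/andP; split.
  by apply: ereal_inf_lbound; exists U => //; split.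
by apply: le_ereal_inf_tmp => _ [V [oV UV] <-]; exact: inner_le.
Qed.

Let outer_compact K : compact K -> outer_content K = (psi K)%:E.
Proof.
move=> cK; apply/eqP; rewrite eq_le; apply/andP; split; last first.
  by apply: le_ereal_inf_tmp => _ [V [oV KV] <-]; exact: inner_ub.
apply/lee_addgt0Pr => e e0; have [G [oG KG Ge]] := psi_cont cK e0.
apply: (@le_trans _ _ (inner_content G)).
  by apply: ereal_inf_lbound; exists G => //; split.
apply: ge_ereal_sup => _ [L [cL LG] <-]; rewrite -EFinD lee_fin.
(* Right continuity only controls compact sets between [K] and [G], so [L] is enlarged to its union
   with [K]. *)
have cLK : compact (L `|` K) by exact: compactU.
apply: le_trans (psi_le cL cLK _) _; first exact: subsetUl.
have := Ge _ cLK (@subsetUr _ _ _); rewrite subUset => /(_ (conj LG KG)).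
by move=> /(le_lt_trans (ler_norm _)); rewrite ltrBlDl => /ltW.
Qed.

Let outer0 : outer_content set0 = 0.
Proof. by rewrite outer_compact ?psi0//; exact: compact0. Qed.

(** Induction on [n]: [compact_split] cuts off the part of [K] inside the last open set. *)
Let inner_bigsetU (U : nat -> set T) n K : (forall i, open (U i)) -> compact K ->
  K `<=` \big[setU/set0]_(i < n) U i -> (psi K)%:E <= \sum_(i < n) inner_content (U i).
Proof.
move=> oU; elim: n K => [|n IH] K cK.
  by rewrite !big_ord0 subset0 => ->; rewrite psi0.
rewrite !big_ord_recr/= => KU.
have [||K1 [K2 [c1 c2 K1U K2U ->]]] := compact_split lcT hT cK _ _ KU.
- by rewrite -bigcup_mkord; exact: bigcup_open.
- exact: oU.
apply: (@le_trans _ _ ((psi K1)%:E + (psi K2)%:E)); first by rewrite -EFinD lee_fin psiU.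
by apply: leeD; [exact: IH|exact: inner_ub].
Qed.

Let inner_bigcup (U : nat -> set T) : (forall i, open (U i)) ->
  inner_content (\bigcup_i U i) <= \sum_(i <oo) inner_content (U i).
Proof.
move=> oU; apply: ge_ereal_sup => _ [K [cK KU] <-].
have [n KUn] := compact_initial_cover cK oU KU.
apply: le_trans (inner_bigsetU oU cK KUn) _.
by rewrite -(big_mkord xpredT (fun i => inner_content (U i))); exact: nneseries_lim_ge.
Qed.

Let outer_sigma_subadditive : sigma_subadditive outer_content.
Proof.
move=> A; apply/lee_addgt0Pr => e e0.
apply: le_trans (epsilon_trick xpredT _ (ltW e0)) => //.
have /choice[U UP] : forall n, exists U, [/\ open U, A n `<=` U &
    inner_content U <= outer_content (A n) + (e / (2 ^ n.+1)%:R)%:E].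
  move=> n; have [fA|] := boolP (outer_content (A n) \is a fin_num); last first.
    rewrite ge0_fin_numE// -leNgt leye_eq => /eqP ->.
    by exists setT; split; [exact: openT| |rewrite addye// leey].
  have en : (0 < e / (2 ^ n.+1)%:R)%R by rewrite divr_gt0.
  have [_ [U [oU AU] <-] /ltW] := lb_ereal_inf_adherent en fA.
  by exists U.
apply: (@le_trans _ _ (inner_content (\bigcup_n U n))).
  apply: ereal_inf_lbound; exists (\bigcup_n U n) => //; split.
    by apply: bigcup_open => n _; case: (UP n).
  by move=> x [n _ Anx]; exists n => //; case: (UP n) => _ + _; apply.
apply: le_trans (inner_bigcup _) _; first by move=> n; case: (UP n).
by apply: lee_nneseries => // n _; case: (UP n).
Qed.

HB.instance Definition _ := isOuterMeasure.Build R T outer_content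
  outer0 outer_ge0 outer_le outer_sigma_subadditive.

(** After replacing [A] by an open [V], a compact [K] inside the intersection of [V] and [U] nearly
    exhausts its content, and a compact [L] inside [V \ K] does the same there. As [K] and [L] are
    disjoint, modularity gives [psi L + psi K] as the value of [psi] on a compact subset of [V]. *)
Let open_caratheodory U : open U -> outer_content.-caratheodory U.
Proof.
move=> oU; apply: le_caratheodory_measurable => A.
apply: le_ereal_inf_tmp => _ [V [oV AV] <-].
apply: (@le_trans _ _ (inner_content (V `&` U) + outer_content (V `\` U))).
  apply: leeD; last by apply: outer_le; exact: setSI.
  rewrite -outer_open; last exact: openI.
  by apply: outer_le; exact: setSI.
have [fV|] := boolP (inner_content V \is a fin_num); last first.
  by rewrite ge0_fin_numE// -leNgt leye_eq => /eqP ->; rewrite leey.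
have fVU : outer_content (V `\` U) \is a fin_num.
  rewrite ge0_fin_numE//; apply: le_lt_trans (_ : inner_content V < +oo).
    by rewrite -outer_open//; apply: outer_le; exact: subDsetl.
  by rewrite -ge0_fin_numE.
rewrite -leeBrDr//; apply: ge_ereal_sup => _ [K [cK KVU] <-].
rewrite leeBrDr// addeC -leeBrDr//.
have oVK : open (V `\` K).
  by apply: openI => //; apply: closed_openC; exact: compact_closed.
apply: (@le_trans _ _ (inner_content (V `\` K))).
  rewrite -outer_open//; apply: outer_le => x [Vx nUx]; split=> // Kx.
  by have [] := KVU _ Kx.
apply: ge_ereal_sup => _ [L [cL LVK] <-].
rewrite leeBrDr// -EFinD psi_mod//.
have -> : L `&` K = set0 by rewrite -subset0 => x [/LVK[]].
rewrite psi0 addr0; apply: inner_ub; first exact: compactU.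
by rewrite subUset; split=> x; [move=> /LVK[]|move=> /KVU[]].
Qed.

Let borel_caratheodory : borel (T := T) `<=` outer_content.-caratheodory.
Proof.
apply: smallest_sub => [|U oU]; last exact: open_caratheodory.
split.
- exact: caratheodory_measurable_set0.
- by move=> A mA; rewrite setTD; exact: caratheodory_measurable_setC.
- by move=> F mF; exact: caratheodory_measurable_bigcup.
Qed.

Let outer_borel_measure : borel_measure outer_content.
Proof.
split=> // F mF tF.
have cF n := borel_caratheodory (mF n).
have -> : outer_content (\bigcup_n F n) = \sum_(n <oo) outer_content (F n).
  apply/eqP; rewrite eq_le outer_sigma_subadditive/=.
  (* The missing inequality is the Caratheodory property tested on the union itself. *)
  have := caratheodory_lime_le cF tF (\bigcup_n F n); rewrite setICr outer_measure0 adde0.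
  by under eq_eseriesr => n _ do rewrite (setIidr (bigcup_sup (i := n) I)).
exact: is_cvg_nneseries.
Qed.

Lemma radon_extension :
  radon_measure outer_content /\
  forall Q, compact Q -> outer_content Q = (psi Q)%:E.
Proof.
split; last exact: outer_compact.
split.
- exact: outer_borel_measure.
- by move=> Q cQ; rewrite outer_compact// ltry.
- move=> U oU; rewrite outer_open//; congr ereal_sup.
  by apply/seteqP; split=> _ [Q [cQ QU] <-]; exists Q => //; rewrite outer_compact.
- move=> B bB; congr ereal_inf.
  by apply/seteqP; split=> _ [U [oU BU] <-]; exists U => //; rewrite outer_open.
Qed.

End radon_extension.

(** * Construction of the process *)

Section exhaustion.
Context (T : topologicalType).
Hypotheses (scT : sigma_compact T) (lcT : locally_compact [set: T]).

Lemma compact_exhaustion : exists L : nat -> set T,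
  [/\ L 0%N = set0, forall n, compact (L n), nondecreasing_seq L &
      forall K, compact K -> exists m, K `<=` (L m)°].
Proof.
have [C [cC CT]] := scT.
have /choice[V VP] : forall K : set T, exists V, compact K -> compact V /\ K `<=` V°.
  move=> K; have [cK|nK] := pselect (compact K); last by exists set0.
  by have [V cV KV] := compact_nbhs lcT cK; exists V.
(* Each step absorbs one more set of the countable cover and then fattens, so that the interiors
   increase to the whole space; starting from the empty set lets the shells cover everything. *)
pose L := fix L n := if n is n'.+1 then V (L n' `|` C n') else set0.
have cL n : compact (L n).
  elim: n => [|n IH] /=; first exact: compact0.
  by have [] := VP (L n `|` C n) (compactU IH (cC n)).
have LS n : L n `|` C n `<=` (L n.+1)°.
  by have [] := VP (L n `|` C n) (compactU (cL n) (cC n)).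
exists L; split=> //.
  apply/nondecreasing_seqP => n; apply/subsetPset => x Lx.
  by apply: interior_subset; apply: LS; left.
move=> K cK; have [||n Kn] := @compact_initial_cover T K (fun n => (L n)°) cK.
- by move=> n; exact: open_interior.
- move=> x _; have : (\bigcup_n C n) x by rewrite CT.
  by move=> [n _ Cx]; exists n.+1 => //; apply: LS; right.
exists n; apply: subset_trans Kn _.
rewrite -(bigcup_mkord n (fun i => (L i)°)) => x [i /= ilt].
apply: interiorS; elim: n ilt => // n IH; rewrite ltnS leq_eqVlt => /predU1P[->|/IH iL].
  by move=> y Ly; apply: interior_subset; apply: LS; left.
by move=> y /iL Ly; apply: interior_subset; apply: LS; left.
Qed.

End exhaustion.

Section option_space.
Context (T : topologicalType).

(* The extra point None makes the space pointed even when T is empty, and it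
   absorbs the part of the sampling laws that must not produce any point. *)
Definition option_space := option T.

HB.instance Definition _ := Pointed.on option_space.

Definition option_borel : set (set option_space) :=
  [set A | borel (Some @^-1` A)].

Lemma borel_sigma_algebra : sigma_algebra setT (borel (T := T)).
Proof. exact: smallest_sigma_algebra. Qed.

Let option_borel0 : option_borel set0.
Proof. by rewrite /option_borel/= preimage_set0; case: borel_sigma_algebra. Qed.

Let option_borelC A : option_borel A -> option_borel (~` A).
Proof.
rewrite /option_borel/= => bA; rewrite preimage_setC -setTD.
by case: borel_sigma_algebra => _ + _; exact.
Qed.

Let option_borel_bigcup (F : (set option_space)^nat) :
  (forall i, option_borel (F i)) -> option_borel (\bigcup_i F i).
Proof.
rewrite /option_borel/= => bF; rewrite preimage_bigcup.
by case: borel_sigma_algebra => _ _; exact.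
Qed.

HB.instance Definition _ := @isMeasurable.Build default_measure_display
  option_space option_borel option_borel0 option_borelC option_borel_bigcup.

Lemma borel_open (U : set T) : open U -> borel U.
Proof. exact: sub_sigma_algebra. Qed.

Lemma borel_compact (K : set T) : hausdorff_space T -> compact K -> borel K.
Proof.
move=> hT /(compact_closed hT)/closed_openC/borel_open bK; rewrite -(setCK K) -setTD.
by case: borel_sigma_algebra => _ + _; exact.
Qed.

Lemma preimage_Some_image (B : set T) : Some @^-1` (Some @` B) = B.
Proof. by apply/seteqP; split=> [x [y By [<-]]|x Bx] //; exists x. Qed.

Lemma measurable_Some (B : set T) : borel B -> measurable (Some @` B : set option_space).
Proof. by move=> bB; rewrite /measurable/= /option_borel/= preimage_Some_image. Qed.

End option_space.

Section lift_measure.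
Context (R : realType) (T : topologicalType) (lambda : set T -> \bar R).
Hypothesis lambda_borel : borel_measure lambda.
Local Open Scope ereal_scope.

(* The value 0 off the measurable sets is there because the library asks
   measures to be nonnegative on all sets. *)
Definition lift_measure of borel_measure lambda := fun A : set (option_space T) =>
  if `[< measurable A >] then lambda (Some @^-1` A) else 0.

Let mu := lift_measure lambda_borel.

Let muE A : measurable A -> mu A = lambda (Some @^-1` A).
Proof. by rewrite /mu /lift_measure => /asboolP ->. Qed.

Let mu0 : mu set0 = 0.
Proof. by rewrite muE// preimage_set0; case: lambda_borel. Qed.

Let mu_ge0 A : 0 <= mu A.
Proof.
rewrite /mu /lift_measure; case: asboolP => // mA.
by case: lambda_borel => _ + _; apply.
Qed.

Let mu_semi_sigma_additive : semi_sigma_additive mu.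
Proof.
move=> F mF tF mUF; rewrite muE// preimage_bigcup.
under eq_fun do under eq_bigr do rewrite muE//.
case: lambda_borel => _ _; apply; first exact: mF.
by move=> i j _ _ [x [Fix Fjx]]; apply: tF => //; exists (Some x).
Qed.

HB.instance Definition _ := isMeasure.Build _ _ _ (lift_measure lambda_borel)
  mu0 mu_ge0 mu_semi_sigma_additive.

Lemma lift_measureE B : borel B -> lift_measure lambda_borel (Some @` B) = lambda B.
Proof. by move=> bB; rewrite -/mu muE ?preimage_Some_image//; exact: measurable_Some. Qed.

End lift_measure.

Section borel_measure_lemmas.
Context (T : topologicalType).
Implicit Types A B : set T.

Lemma Some_imageI A B : Some @` (A `&` B) = (Some @` A) `&` (Some @` B).
Proof.
apply/seteqP; split=> [_ [x [Ax Bx] <-]|_ [[x Ax <-] [y By [yx]]]].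
  by split; exists x.
by exists x => //; split=> //; rewrite -yx.
Qed.

Lemma Some_imageD A B : Some @` (A `\` B) = (Some @` A) `\` (Some @` B).
Proof.
apply/seteqP; split=> [_ [x [Ax Bx] <-]|_ [[x Ax <-] nBx]].
  by split; [exists x|move=> [y By [yx]]; apply: Bx; rewrite -yx].
by exists x => //; split=> // Bx; apply: nBx; exists x.
Qed.

Lemma borelD A B : borel A -> borel B -> borel (A `\` B).
Proof.
move=> bA bB; rewrite -(preimage_Some_image (A `\` B)) Some_imageD.
exact: (measurableD (measurable_Some bA) (measurable_Some bB)).
Qed.

Lemma borelI A B : borel A -> borel B -> borel (A `&` B).
Proof.
move=> bA bB; rewrite -(preimage_Some_image (A `&` B)) Some_imageI.
exact: (measurableI _ _ (measurable_Some bA) (measurable_Some bB)).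
Qed.

Context (R : realType) (lambda : set T -> \bar R).
Hypothesis lambda_borel : borel_measure lambda.

Lemma borel_measure_ge0 A : borel A -> (0 <= lambda A)%E.
Proof. by case: lambda_borel => _ + _; apply. Qed.

(** Transferred from the measure [lift_measure]: the embedding [Some] commutes with intersections
    and differences. *)
Lemma borel_measureDI A B : borel A -> borel B ->
  (lambda A = lambda (A `\` B) + lambda (A `&` B))%E.
Proof.
move=> bA bB; have mA := measurable_Some bA; have mB := measurable_Some bB.
rewrite -!(lift_measureE lambda_borel)//; last 2 first.
  exact: borelI.
  exact: borelD.
by rewrite Some_imageI Some_imageD -measureDI.
Qed.

Lemma le_borel_measure A B : borel A -> borel B -> A `<=` B -> (lambda A <= lambda B)%E.
Proof.
move=> bA bB AB; rewrite (borel_measureDI bB bA) (setIidr AB).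
by apply: leeDr; apply: borel_measure_ge0; exact: borelD.
Qed.

Lemma borel_measure_modular A B : borel A -> borel B ->
  (lambda A + lambda B = lambda (A `|` B) + lambda (A `&` B))%E.
Proof.
move=> bA bB; have bU : borel (A `|` B).
  have bT : borel [set: T] by exact: borel_open openT.
  by rewrite -[A `|` B]setCK setCU -!setTD; apply: borelD => //; apply: borelI;
    exact: borelD.
rewrite (borel_measureDI bA bB) (borel_measureDI bU bB).
have -> : (A `|` B) `&` B = B by rewrite setIUl setIid; apply: setUidr; exact: subIsetr.
have -> : (A `|` B) `\` B = A `\` B by rewrite setDUl setDv setU0.
by rewrite addeAC.
Qed.

Lemma fin_num_radon_compact K : radon_measure lambda -> hausdorff_space T -> compact K ->
  lambda K \is a fin_num.
Proof.
move=> [_ Hfin _ _] hT cK; rewrite ge0_fin_numE ?Hfin//.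
by apply: borel_measure_ge0; exact: borel_compact.
Qed.

End borel_measure_lemmas.

Lemma measurable_fun_nat d (X : measurableType d) (f : X -> nat) :
  (forall n, measurable [set x | f x = n]) -> measurable_fun setT f.
Proof.
move=> mf _ Y _; rewrite setTI.
rewrite (_ : f @^-1` Y = \bigcup_(n in Y) [set x | f x = n]).
  by apply: bigcup_measurable => n _; exact: mf.
by apply/seteqP; split=> [x Yx|x [n Yn fx]]; [exists (f x)|rewrite /preimage/= fx].
Qed.

Section poisson_process.
Context (R : realType) (T : topologicalType).
Hypothesis hT : hausdorff_space T.
Variable lambda : set T -> \bar R.
Hypothesis lambda_radon : radon_measure lambda.
Variable L : nat -> set T.
Hypotheses (L0 : L 0%N = set0) (cL : forall n, compact (L n))
  (Lnd : nondecreasing_seq L)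
  (Lcover : forall K, compact K -> exists m, K `<=` (L m)°).

Let lambda_borel : borel_measure lambda. Proof. by case: lambda_radon. Qed.

Let shell n : set T := L n.+1 `\` L n.

Let borelL n : borel (L n). Proof. exact: borel_compact. Qed.
Let borel_shell n : borel (shell n). Proof. exact: borelD. Qed.

Let S := option_space T.

Let trace (B : set T) n : set S := Some @` (B `&` shell n).

Let measurable_trace B n : borel B -> measurable (trace B n).
Proof. by move=> bB; apply: measurable_Some; exact: borelI. Qed.

(* The summand 1 is the mass of None: it keeps the rate positive on shells of
   measure zero, and does not show in the counts. *)
Let rate n : R := fine (lambda (shell n)) + 1.

Let rate_gt0 n : 0 < rate n.
Proof. by apply: ltr_wpDl => //; apply: fine_ge0; exact: borel_measure_ge0. Qed.

Let shell_measure n : {measure set S -> \bar R} :=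
  measure_add (mrestr (lift_measure lambda_borel) (measurable_Some (borel_shell n)))
              (dirac (None : S)).

(** The total mass of [shell_measure n] is [rate n], finite and positive, so the default law given
    to [mnormalize] never comes into play. *)
Let rho n : probability S R := mnormalize (shell_measure n) (dirac (None : S)).

Let fin_shell n : lambda (shell n) \is a fin_num.
Proof.
rewrite ge0_fin_numE; last exact: borel_measure_ge0.
apply: le_lt_trans (_ : lambda (L n.+1) < +oo)%E.
  by apply: le_borel_measure => //; exact: subDsetl.
by rewrite -ge0_fin_numE; [exact: fin_num_radon_compact|exact: borel_measure_ge0].
Qed.

Let rate_rho B n : borel B ->
  rate n * fine (rho n (trace B n)) = fine (lambda (B `&` shell n)).
Proof.
move=> bB; have bBs : borel (B `&` shell n) by exact: borelI.
have sE A : (shell_measure n A =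
    lift_measure lambda_borel (A `&` Some @` shell n) + \d_(None : S) A)%E.
  exact: measure_addE.
have sT : shell_measure n setT = (rate n)%:E.
  rewrite sE setTI lift_measureE// diracT.
  by rewrite EFinD fineK.
have sB : shell_measure n (trace B n) = lambda (B `&` shell n).
  rewrite sE /trace -Some_imageI.
  rewrite -setIA setIid lift_measureE// diracE memNset ?adde0//.
  by move=> [].
have fB : lambda (B `&` shell n) \is a fin_num.
  rewrite ge0_fin_numE; last exact: borel_measure_ge0.
  apply: le_lt_trans (_ : lambda (shell n) < +oo)%E; last by rewrite ltey_eq fin_shell.
  by apply: le_borel_measure => //; exact: subIsetr.
have -> : rho n (trace B n) = (lambda (B `&` shell n) * ((rate n)^-1)%:E)%E.
  rewrite -sB /rho/= /mnormalize sT eqe gt_eqF//.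
by rewrite -(fineK fB) -EFinM/= mulrCA divff ?mulr1// gt_eqF.
Qed.

Let Omega := seq_measurableType (level_space S).

Let P : probability Omega R :=
  product_measure (fun n => level_measure (rho n) (rate n)).

(** An arbitrary level containing [Q], with default 0 if there is none; [N_E] shows that the choice
    is immaterial for compact sets. *)
Let depth (Q : set T) : nat := xget 0%N [set m | Q `<=` L m].

Let depthP (Q : set T) : compact Q -> Q `<=` L (depth Q).
Proof.
move=> /Lcover[m Qm]; apply: (xgetPex 0%N (P := [set m | Q `<=` L m])).
by exists m => x /Qm; exact: interior_subset.
Qed.

(** A process assigns a random variable to every set, so non-compact sets are sent to the empty set
    to keep [count] measurable. *)
Let cpt (Q : set T) : set T := if `[< compact Q >] then Q else set0.

Let compact_cpt Q : compact (cpt Q).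
Proof. by rewrite /cpt; case: asboolP => // _; exact: compact0. Qed.

Let cptE Q : compact Q -> cpt Q = Q.
Proof. by rewrite /cpt => /asboolP ->. Qed.

Let count (Q : set T) (w : Omega) : nat :=
  (\sum_(n < depth (cpt Q)) hits (trace (cpt Q) n) (w n))%N.

Let measurable_count Q : measurable_fun setT (count Q).
Proof.
apply: measurable_fun_nat => u.
have [] := levels_law rho rate_gt0 (k := 1) (A := fun _ n => trace (cpt Q) n)
    (depth (cpt Q)) (fun=> u).
- by move=> _ n; apply: measurable_trace; exact: borel_compact.
- by move=> n i j _ _ _; rewrite !ord1.
- move=> + _; congr measurable; apply/seteqP; split=> w /=; first by move=> /(_ ord0).
  by move=> + _.
Qed.

HB.instance Definition _ Q :=
  isMeasurableFun.Build _ _ _ _ (count Q) (measurable_count Q).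

Let N (Q : set T) : {RV P >-> nat} := count Q.

Let trace_eq0 Q m n : Q `<=` L m -> (m <= n)%N -> trace Q n = set0.
Proof.
move=> QL mn; apply/seteqP; split=> // _ [x [Qx [_ nLx]] <-]; apply: nLx.
have /subsetPset := Lnd mn; apply; exact: QL.
Qed.

(** Shells from level [m] on do not meet [Q]. Several compact sets can thus be counted over the same
    range of shells. *)
Let N_E Q m w : compact Q -> Q `<=` L m ->
  N Q w = (\sum_(n < m) hits (trace Q n) (w n))%N.
Proof.
move=> cQ Qm; rewrite /N /= /count (cptE cQ).
have Qd := depthP cQ.
have hits0 (B : set S) x : B = set0 -> hits B x = 0%N.
  by move=> ->; rewrite /hits big1// => j _; rewrite in_set0.
have aux m1 m2 : Q `<=` L m1 -> (m1 <= m2)%N ->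
  (\sum_(n < m1) hits (trace Q n) (w n) = \sum_(n < m2) hits (trace Q n) (w n))%N.
  move=> Q1 m12; rewrite -!(big_mkord xpredT (fun n => hits (trace Q n) (w n))).
  rewrite [RHS](big_cat_nat (leq0n m1) m12)/= [X in (_ + X)%N]big1_seq ?addn0// => n.
  rewrite mem_index_iota => /andP[_ /andP[m1n _]]; apply: hits0; exact: trace_eq0 Q1 m1n.
by have [dm|/ltnW md] := leqP (depth Q) m; [exact: aux|exact/esym/aux].
Qed.

Let common_depth (Q1 Q2 : set T) : compact Q1 -> compact Q2 ->
  exists m, Q1 `<=` L m /\ Q2 `<=` L m.
Proof.
move=> c1 c2; have [m Hm] := Lcover (compactU c1 c2 : compact (Q1 `|` Q2)); exists m.
by split=> x Qx; apply: interior_subset; apply: Hm; [left|right].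
Qed.

Let process_valuation : point_process N.
Proof.
move=> w; split.
- by move=> Q _; exact: ler0n.
- move=> E F cE cF EF; rewrite ler_nat.
  have [m [Em Fm]] := common_depth cE cF; rewrite (N_E w cE Em) (N_E w cF Fm).
  apply: leq_sum => n _; apply: leq_sum => j _.
  case: (boolP (_ \in trace E n)) => // /set_mem[x [Ex sx] <-].
  by rewrite mem_set//; exists x => //; split=> //; exact: EF.
- move=> E e cE e0; have [m Em] := Lcover cE.
  (* The finitely many sampled points of levels below [m] that miss [E]. Once they are removed from
     the interior of [L m], enlarging [E] inside what is left catches no new point. *)
  pose X : set T := \bigcup_(n in `I_m) \bigcup_(j in `I_(w n).1)
    [set t | (w n).2 j = Some t /\ ~ E t].
  have fX : finite_set X.
    apply: bigcup_finite => [|n _]; first exact: finite_II.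
    apply: bigcup_finite => [|j _]; first exact: finite_II.
    case wnj: ((w n).2 j) => [t|]; last first.
      by rewrite (_ : [set _ | _] = set0)//; apply/seteqP; split=> // ? [].
    apply: (@sub_finite_set _ _ [set t]); last exact: finite_set1.
    by move=> x [[->] _].
  have clX : closed X.
    exact: (accessible_finite_set_closed.1 (hausdorff_accessible hT)).
  exists ((L m)° `&` ~` X); split.
  + by apply: openI; [exact: open_interior|exact: closed_openC].
  + by move=> x Ex; split; [exact: Em|move=> [n _ [j _ [_ []]]]].
  + move=> F cF EF FG.
    have Fm : F `<=` L m by move=> x /FG[/interior_subset].
    have Em' : E `<=` L m by move=> x /Em/interior_subset.
    rewrite (N_E w cE Em') (N_E w cF Fm).
    rewrite (eq_bigr (fun n : 'I_m => hits (trace E n) (w n))) ?subrr ?normr0//.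
    move=> n _; apply: eq_bigr => j _; congr nat_of_bool.
    apply/idP/idP => /set_mem[x [Hx sx] wx]; apply/mem_set; exists x => //; split=> //.
      apply: contrapT => nEx; have [_] := FG _ Hx; apply.
      by exists n; [exact: ltn_ord|exists j; [exact: ltn_ord|]].
    exact: EF.
- by rewrite (@N_E set0 0%N) ?big_ord0//; exact: compact0.
- move=> Q1 Q2 c1 c2; have [m [m1 m2]] := common_depth c1 c2.
  have cU : compact (Q1 `|` Q2) by exact: compactU.
  have cI : compact (Q1 `&` Q2) by apply: compact_closedI => //; exact: compact_closed.
  have mU : Q1 `|` Q2 `<=` L m by rewrite subUset.
  have mI : Q1 `&` Q2 `<=` L m by move=> x [/m1].
  rewrite (N_E w c1 m1) (N_E w c2 m2) (N_E w cU mU) (N_E w cI mI) -!natrD; congr _%:R.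
  rewrite -!big_split/=; apply: eq_bigr => n _; rewrite -!big_split/=.
  apply: eq_bigr => j _.
  (* Modularity holds draw by draw: it is inclusion-exclusion for the membership of one point. *)
  have -> : trace (Q1 `|` Q2) n = trace Q1 n `|` trace Q2 n.
    by rewrite /trace setIUl image_setU.
  have -> : trace (Q1 `&` Q2) n = trace Q1 n `&` trace Q2 n.
    by rewrite /trace -Some_imageI setIACA setIid.
  by rewrite in_setU in_setI; do 2 case: (_ \in trace _ _).
Qed.

(** The shells below [m] partition [L m], because [L 0] is empty. *)
Let lambda_shells Q m : borel Q ->
  \sum_(n < m) fine (lambda (Q `&` shell n)) = fine (lambda (Q `&` L m)).
Proof.
move=> bQ; elim: m => [|m IH].
  by rewrite big_ord0 L0 setI0; case: lambda_borel => ->.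
have bQL n : borel (Q `&` L n) by exact: borelI.
have fL n : lambda (Q `&` L n) \is a fin_num.
  rewrite ge0_fin_numE; last exact: borel_measure_ge0.
  apply: le_lt_trans (_ : lambda (L n) < +oo)%E.
    by apply: le_borel_measure => //; exact: subIsetr.
  by rewrite ltey_eq fin_num_radon_compact.
have LS : L m `<=` L m.+1 by have /subsetPset := Lnd (leqnSn m).
rewrite big_ord_recr/= IH [in RHS](borel_measureDI lambda_borel (bQL m.+1) (borelL m)).
have -> : (Q `&` L m.+1) `\` L m = Q `&` shell m by rewrite /shell setIDA.
have -> : Q `&` L m.+1 `&` L m = Q `&` L m by rewrite -setIA (setIidr LS).
rewrite fineD ?fL// 1?addrC//.
rewrite ge0_fin_numE; last by apply: borel_measure_ge0 => //; exact: borelI.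
apply: le_lt_trans (_ : lambda (shell m) < +oo)%E; last by rewrite ltey_eq fin_shell.
by apply: le_borel_measure => //; do ?[exact: borelI|exact: subIsetr].
Qed.

(** Finitely many compact sets fit in one [L m], and their traces on each shell are disjoint.
    [levels_law] then applies, with parameters that [rate_rho] and [lambda_shells] sum to
    [lambda (Q i)]. *)
Let process_law (k : nat) (Q : 'I_k -> set T) (v : 'I_k -> nat) :
  (forall i, compact (Q i)) -> trivIset setT Q ->
  P [set w | forall i, N (Q i) w = v i] =
  (\prod_(i < k) poisson_weight (fine (lambda (Q i))) (v i))%:E.
Proof.
move=> cQ tQ.
have [m Qm] : exists m, forall i, Q i `<=` L m.
  have /choice[f fP] : forall i, exists m, Q i `<=` (L m)° by move=> i; exact: Lcover.
  exists (\max_i f i) => i x /fP/interior_subset.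
  by have /subsetPset := Lnd (leq_bigmax (F := f) i); apply.
have tA n : trivIset setT (fun i => trace (Q i) n).
  move=> i j _ _ [_ [[x [Qix _] <-] [y [Qjy _] [yx]]]]; apply: tQ => //.
  by exists x; split=> //; rewrite -yx.
have bQ i : borel (Q i) by exact: borel_compact.
have [_] := levels_law rho rate_gt0 (A := fun i n => trace (Q i) n) m v
  (fun i n => measurable_trace n (bQ i)) tA.
rewrite (_ : [set w | forall i, N (Q i) w = v i] = [set w : Omega |
    forall i, (\sum_(n < m) hits (trace (Q i) n) (w n))%N = v i]); last first.
  by apply/seteqP; split=> w H i; have := H i; rewrite (N_E w (cQ i) (Qm i)).
move=> E; apply: etrans E _; congr EFin; apply: eq_bigr => i _; congr poisson_weight.
under eq_bigr do rewrite rate_rho//.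
by rewrite lambda_shells// (setIidl (Qm i)).
Qed.

Lemma exists_poisson_process :
  exists (d : measure_display) (Omega : measurableType d)
    (P : probability Omega R) (N : set T -> {RV P >-> nat}),
    point_process N /\
    forall (k : nat) (Q : 'I_k -> set T) (v : 'I_k -> nat),
      (forall i, compact (Q i)) -> trivIset setT Q ->
      P [set w | forall i, N (Q i) w = v i] =
      (\prod_(i < k) poisson_weight (fine (lambda (Q i))) (v i))%:E.
Proof.
exists _, [the measurableType _ of Omega], P, N.
by split; [exact: process_valuation|exact: process_law].
Qed.

End poisson_process.

(** * The characterization *)

Lemma neg_ln_valuation (R : realType) (T : topologicalType) (phi : set T -> R) :
  conjugate_functional phi -> phi set0 = 1 ->
  (forall Q, compact Q -> 0 < phi Q) ->
  (forall Q1 Q2, compact Q1 -> compact Q2 ->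
    phi Q1 * phi Q2 = phi (Q1 `|` Q2) * phi (Q1 `&` Q2)) ->
  (forall Q1 Q2 : set T, compact Q1 -> compact Q2 -> compact (Q1 `&` Q2)) ->
  valuation (fun Q => - ln (phi Q)).
Proof.
move=> [_ phi_le phi_cont] phi0 phi_gt0 phiM cI; split.
- move=> Q cQ; rewrite oppr_ge0; apply: ln_le0; rewrite -phi0.
  by apply: phi_le => //; exact: compact0.
- move=> E F cE cF EF; rewrite lerN2 ler_ln ?posrE ?phi_gt0//.
  exact: phi_le.
- move=> E e cE e0.
  (* Continuity of [ln] at the positive number [phi E] turns [e] into the radius [r] to be used in
     the right continuity of [phi]. *)
  have cln : ln x @[x --> phi E] --> ln (phi E).
    by apply: continuous_ln; exact: phi_gt0.
  have : \forall t \near phi E, `|ln (phi E) - ln t| < e.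
    exact: ((cvgrPdist_lt _ _).1 cln e e0).
  move=> /nbhs_ballP[r /= r0 Hr].
  have [G [oG EG GE]] := phi_cont E r cE r0; exists G; split=> // F cF EF FG.
  rewrite -opprD normrN distrC; apply: Hr; rewrite /ball/= distrC.
  exact: GE.
- by rewrite phi0 ln1 oppr0.
- move=> Q1 Q2 c1 c2; have cU : compact (Q1 `|` Q2) by exact: compactU.
  have lnE A B : compact A -> compact B -> ln (phi A) + ln (phi B) = ln (phi A * phi B).
    by move=> cA cB; rewrite lnM ?posrE ?phi_gt0.
  rewrite -[LHS]opprD -[RHS]opprD.
  congr (- _).
  rewrite (lnE _ _ c1 c2).
  rewrite (lnE _ _ cU (cI _ _ c1 c2)).
  by rewrite (phiM _ _ c1 c2).
Qed.

Lemma void_probability (R : realType) (T : topologicalType) d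
    (Omega : measurableType d) (P : probability Omega R)
    (N : set T -> {RV P >-> nat}) (lambda : set T -> \bar R) (Q : set T) :
  (forall (k : nat) (Q : 'I_k -> set T) (v : 'I_k -> nat),
      (forall i, compact (Q i)) -> trivIset setT Q ->
      P [set w | forall i, N (Q i) w = v i] =
      (\prod_(i < k) poisson_weight (fine (lambda (Q i))) (v i))%:E) ->
  compact Q -> P [set w | N Q w = 0%N] = (expR (- fine (lambda Q)))%:E.
Proof.
move=> law cQ; have := law 1%N (fun=> Q) (fun=> 0%N) (fun=> cQ).
rewrite big_ord1 /poisson_weight expr0 fact0 divr1 mulr1 => <-.
  by congr (P _); apply/seteqP; split=> w /=; [move=> + _|move=> /(_ ord0)].
by move=> i j _ _ _; rewrite !ord1.
Qed.

Theorem theorem1p4 (R : realType) (T : topologicalType)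
    (T_sigma_compact : sigma_compact T)
    (T_locally_compact : locally_compact [set: T])
    (T_hausdorff : hausdorff_space T)
    (phi : set T -> R) (phi_conj : conjugate_functional phi)
    (phi0 : phi set0 = 1) :
  (exists (d : measure_display) (Omega : measurableType d)
      (P : probability Omega R) (N : set T -> {RV P >-> nat}),
    general_poisson_process N /\ is_zero_probability_function N phi) <->
  (forall Q : set T, compact Q -> 0 < phi Q) /\
  (forall Q1 Q2 : set T, compact Q1 -> compact Q2 ->
    phi Q1 * phi Q2 = phi (Q1 `|` Q2) * phi (Q1 `&` Q2)).
Proof.
have cI (Q1 Q2 : set T) : compact Q1 -> compact Q2 -> compact (Q1 `&` Q2).
  by move=> c1 c2; apply: compact_closedI => //; exact: compact_closed.
split.
  move=> [d [X [P [N [[_ [lambda lambda_radon law]] zero]]]]].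
  have phiE Q : compact Q -> phi Q = expR (- fine (lambda Q)).
    by move=> cQ; have := zero _ cQ; rewrite (void_probability law cQ) => -[].
  split=> [Q cQ|Q1 Q2 c1 c2]; first by rewrite phiE// expR_gt0.
  have cU : compact (Q1 `|` Q2) by exact: compactU.
  rewrite (phiE Q1)// (phiE Q2)// (phiE _ cU) (phiE _ (cI _ _ c1 c2)).
  have cI12 := cI _ _ c1 c2; have [lambda_borel _ _ _] := lambda_radon.
  have fin_lambda Q : compact Q -> lambda Q \is a fin_num.
    exact: fin_num_radon_compact.
  rewrite -[LHS]expRD -[RHS]expRD -[X in expR X]opprD -[X in _ = expR X]opprD.
  rewrite -[X in expR (- X)]fineD ?fin_lambda//.
  rewrite -[X in _ = expR (- X)]fineD ?fin_lambda//.
  by rewrite (borel_measure_modular lambda_borel)//; exact: borel_compact.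
move=> [phi_gt0 phiM].
have psi_val := neg_ln_valuation phi_conj phi0 phi_gt0 phiM cI.
have [lambda_radon lambdaE] := radon_extension T_locally_compact T_hausdorff psi_val.
have [L [L0 cL Lnd Lcover]] := compact_exhaustion T_sigma_compact T_locally_compact.
have [d [X [P [N [NV law]]]]] :=
  exists_poisson_process T_hausdorff lambda_radon L0 cL Lnd Lcover.
exists d, X, P, N; split.
  (* [poisson_weight] unfolds to the factor in the definition of a general Poisson process, so [law]
     fits by conversion. *)
  by split=> //; eexists; [exact: lambda_radon|exact: law].
move=> Q cQ; rewrite (void_probability law cQ) lambdaE//=.
by rewrite opprK lnK// posrE phi_gt0.
Qed.
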